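(* Let $\mu,\lambda_1,\lambda_2>0$ and $x_0\in\mathbb{R}\setminus\{0\}$. Let $E>0$ be the energy $E=\frac{\mu^2}{2}x_0^2$ associated to the solution $(\bar y,0,0)=(x_0\cos(\mu t),0,0)$ to system (S) for $\varepsilon=0$. For each $i=1,2$ there exists an increasing divergent sequence $\{E^i_m\}_{m=0}^\infty$ such that $E^i_0=0$ and (i) $E$ is non-activating for the residual mode $z_i$ whenever $E\in(E^i_{2k},E^i_{2k+1})$ for some $k\ge 0$; (ii) $E$ is activating for the residual mode $z_i$ whenever $E\in(E^i_{2k+1},E^i_{2k+2})$ for some $k\ge 0$.
   Context: For $\mu,\lambda_1,\lambda_2>0$, $x_0\in\mathbb{R}\setminus\{0\}$ and $\varepsilon\ge 0$, system (S) is the Hamiltonian system $$\begin{cases}\ddot y+\mu^2y+(z_1^2+z_2^2)y=0, & y(0)=x_0,\ \dot y(0)=0,\\ \ddot z_1+\lambda_1^2z_1+(y^2+z_2^2)z_1=0, & z_1(0)=\varepsilon x_0,\ \dot z_1(0)=0,\\ \ddot z_2+\lambda_2^2z_2+(y^2+z_1^2)z_2=0, & z_2(0)=\varepsilon x_0,\ \dot z_2(0)=0.\end{cases}$$ For $\varepsilon=0$ its unique solution is $(\bar y,0,0)=(x_0\cos(\mu t),0,0)$, with conserved energy $E=\frac{\dot y^2}{2}+\frac{\mu^2}{2}y^2=\frac{\mu^2}{2}x_0^2$. The components $z_1,z_2$ are called residual modes. Linearizing the $z_i$ equations around $(\bar y,0,0)$ gives $\ddot\xi_i+\big(\lambda_i^2+\frac{x_0^2}{2}+\frac{x_0^2}{2}\cos(2\mu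 t)\big)\xi_i=0$, which after a change of variables becomes the Mathieu equation in canonical form $$\ddot\xi_i+\big(\alpha_i+2q\cos(2t)\big)\xi_i=0,\qquad \alpha_i=\frac{2\lambda_i^2+x_0^2}{2\mu^2},\qquad q=\frac{x_0^2}{4\mu^2},\qquad i=1,2. \tag{M$_i$}$$ Definition. The energy $E=\frac{\mu^2}{2}x_0^2$ is called activating for the residual mode $z_i$ ($i=1$ or $i=2$) of system (S) if the trivial solution $\xi_i\equiv 0$ of the Mathieu equation (M$_i$) is unstable; otherwise it is called non-activating for $z_i$. *)

(* Defs.v *)
From Stdlib Require Import Reals.
From Coquelicot Require Import Coquelicot.
Open Scope R_scope.

Definition twice_derivable (u : R -> R) : Prop :=
  forall t, ex_derive u t /\ ex_derive (Derive u) t.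

(* The unknowns [z1], [z2] are the residual modes. *)
Definition system_S (mu lambda1 lambda2 x0 eps : R) (y z1 z2 : R -> R) : Prop :=
  (twice_derivable y /\ twice_derivable z1 /\ twice_derivable z2) /\
  (forall t, Derive_n y 2 t + mu ^ 2 * y t
             + (z1 t ^ 2 + z2 t ^ 2) * y t = 0) /\
  (forall t, Derive_n z1 2 t + lambda1 ^ 2 * z1 t
             + (y t ^ 2 + z2 t ^ 2) * z1 t = 0) /\
  (forall t, Derive_n z2 2 t + lambda2 ^ 2 * z2 t
             + (y t ^ 2 + z1 t ^ 2) * z2 t = 0) /\
  (y 0 = x0 /\ Derive y 0 = 0) /\
  (z1 0 = eps * x0 /\ Derive z1 0 = 0) /\
  (z2 0 = eps * x0 /\ Derive z2 0 = 0).

Definition ybar (mu x0 t : R) : R := x0 * cos (mu * t).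

Definition energy (mu : R) (y : R -> R) (t : R) : R :=
  Derive y t ^ 2 / 2 + mu ^ 2 / 2 * y t ^ 2.

Definition mathieu_solution (alpha q : R) (xi : R -> R) : Prop :=
  twice_derivable xi /\
  forall t, Derive_n xi 2 t + (alpha + 2 * q * cos (2 * t)) * xi t = 0.

(* Lyapunov stability of the zero solution in the phase plane (xi, xi').  The
   equation is linear with continuous coefficients, so every solution is
   global and quantifying over solutions on the whole line loses nothing. *)
Definition mathieu_stable (alpha q : R) : Prop :=
  forall t0 eps, 0 < eps ->
  exists delta, 0 < delta /\
    forall xi, mathieu_solution alpha q xi ->
      Rabs (xi t0) < delta -> Rabs (Derive xi t0) < delta ->
      forall t, t0 <= t -> Rabs (xi t) < eps /\ Rabs (Derive xi t) < eps.

Inductive residual_mode : Set := mode_z1 | mode_z2.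

Definition residual_freq (lambda1 lambda2 : R) (i : residual_mode) : R :=
  match i with mode_z1 => lambda1 | mode_z2 => lambda2 end.

Definition mathieu_alpha (mu lambda x0 : R) : R :=
  (2 * lambda ^ 2 + x0 ^ 2) / (2 * mu ^ 2).

Definition mathieu_q (mu x0 : R) : R := x0 ^ 2 / (4 * mu ^ 2).

(* These are properties of the energy mu^2 / 2 * x0^2: the amplitude x0 enters
   only through its square. *)
Definition activating (mu lambda1 lambda2 x0 : R) (i : residual_mode) : Prop :=
  ~ mathieu_stable (mathieu_alpha mu (residual_freq lambda1 lambda2 i) x0)
                   (mathieu_q mu x0).

Definition non_activating (mu lambda1 lambda2 x0 : R) (i : residual_mode) :
  Prop := ~ activating mu lambda1 lambda2 x0 i.

Lemma is_derive_ybar (mu x0 t : R) :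
  is_derive (ybar mu x0) t (- (x0 * mu * sin (mu * t))).
Proof. unfold ybar; auto_derive; [exact I | ring]. Qed.

Lemma is_derive_Derive_ybar (mu x0 t : R) :
  is_derive (Derive (ybar mu x0)) t (- (mu ^ 2 * ybar mu x0 t)).
Proof.
apply is_derive_ext with (fun s => - (x0 * mu * sin (mu * s))).
- intros s; symmetry; apply is_derive_unique, is_derive_ybar.
- unfold ybar; auto_derive; [exact I | ring].
Qed.

Lemma ybar_system_S (mu lambda1 lambda2 x0 : R) :
  system_S mu lambda1 lambda2 x0 0 (ybar mu x0) (fun _ => 0) (fun _ => 0).
Proof.
assert (D0 : forall t, Derive (fun _ : R => 0) t = 0)
  by (intros t; apply Derive_const).
assert (H0 : forall t, is_derive (Derive (fun _ : R => 0)) t 0).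
{ intros t; apply is_derive_ext with (fun _ => 0).
  - intros s; now rewrite D0.
  - apply (is_derive_const 0). }
assert (T0 : twice_derivable (fun _ => 0)).
{ intros t; split; [apply ex_derive_const | now exists 0]. }
assert (E0 : forall t, Derive_n (fun _ : R => 0) 2 t = 0)
  by (intros t; apply is_derive_unique, H0).
repeat split; try apply T0; try (rewrite D0; ring); try ring;
  try (intros t; rewrite E0; ring).
- eexists; apply is_derive_ybar.
- eexists; apply is_derive_Derive_ybar.
- intros t; change (Derive_n (ybar mu x0) 2 t) with (Derive (Derive (ybar mu x0)) t).
  rewrite (is_derive_unique _ _ _ (is_derive_Derive_ybar mu x0 t)); ring.
- unfold ybar; rewrite Rmult_0_r, cos_0; ring.
- rewrite (is_derive_unique _ _ _ (is_derive_ybar mu x0 0)).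
  rewrite Rmult_0_r, sin_0; ring.
Qed.

Lemma energy_ybar (mu x0 t : R) :
  energy mu (ybar mu x0) t = mu ^ 2 / 2 * x0 ^ 2.
Proof.
unfold energy; rewrite (is_derive_unique _ _ _ (is_derive_ybar mu x0 t)).
unfold ybar; assert (H := sin2_cos2 (mu * t)); unfold Rsqr in H.
replace (mu ^ 2 / 2 * x0 ^ 2)
  with (mu ^ 2 / 2 * x0 ^ 2 * (sin (mu * t) * sin (mu * t) + cos (mu * t) * cos (mu * t)))
  by (rewrite H; ring).
field.
Qed.

(* Main.v *)
Require Import Defs.
From Stdlib Require Import Reals ZArith Lra Lia.
From Coquelicot Require Import Coquelicot.
Open Scope R_scope.

(** With [s = x0^2 / mu^2] and [c = lambda^2 / mu^2] the Mathieu equation is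
    [xi'' + (c + s cos^2 t) xi = 0], so along the energy axis only [s] varies.
    Let [u], [v] be the fundamental solutions, and let [a, a', b, b'] be the
    values of [u, u', v, v'] at [pi/2].  Reflection about [pi/2] gives the
    monodromy matrix [[D, 2bb'], [2aa', D]] with [D^2 - 4aa'bb' = 1]: the origin
    is stable when [aa'bb' < 0] and unstable when [aa'bb' > 0].

    In terms of the polar angles of [u] and [v], in units of [pi/2], this is the
    sign of [sin(pi X) sin(pi Y)], where [X], [Y] depend continuously on [s],
    increase strictly, satisfy [|X - Y| < 1] and tend to infinity, and have the
    same integer part at [s = 0].  Hence stability changes exactly where [X] or
    [Y] crosses an integer, and the crossings occur in pairs.  The two crossings
    of a pair are distinct by Ince's theorem: for [s <> 0] a nontrivial even and a
    nontrivial odd solution are never both periodic or both antiperiodic, because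
    their Fourier coefficients satisfy the same three-term recurrence and decay. *)

(** * Picard iteration *)

(** Angles are preferred to the trace of the monodromy matrix because they are monotone in the
    parameter: the angle equation [phi' = sin^2 phi + p cos^2 phi] increases with [p], and
    [p = c + s cos^2 t] increases with [s]. The equation is also scalar, with a bounded and globally
    Lipschitz right-hand side, so one-dimensional Picard iteration gives angles on the whole line,
    and the solutions of the linear equation are rebuilt from the angles instead of the converse.
    When [lambda / mu] is an integer, [X] and [Y] both start on that same integer at [s = 0]. This
    contact is not counted as a crossing: the cells are closed on the left, and the first interval
    after [0] is still one of stability. Strict growth of the sequence is where the difficulty lies:
    two equal crossings would be an instability interval collapsed to a point. Ince's theorem
    excludes this, and the argument needs no completeness of the trigonometric system, since only
    the positivity of the two solutions just after [0] has to be contradicted. *)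

Lemma derive_nonneg_le (f df : R -> R) (a b : R) :
  a <= b ->
  (forall x, a <= x <= b -> is_derive f x (df x)) ->
  (forall x, a <= x <= b -> 0 <= df x) -> f a <= f b.
Proof.
intros hab hf hp.
destruct (MVT_gen f a b df) as [x [hx e]].
- rewrite Rmin_left, Rmax_right by lra; intros x hx; apply hf; lra.
- rewrite Rmin_left, Rmax_right by lra; intros x hx.
  apply continuity_pt_filterlim, (ex_derive_continuous f x).
  exists (df x); apply hf; lra.
- rewrite Rmin_left, Rmax_right in hx by lra.
  assert (0 <= df x * (b - a)) by (apply Rmult_le_pos; [apply hp|]; lra).
  lra.
Qed.

Lemma derive_zero_const (f : R -> R) :
  (forall t, is_derive f t 0) -> forall t, f t = f 0.
Proof.
intros hf t.
destruct (MVT_gen f 0 t (fun _ => 0)) as [x [_ e]]; [auto| |lra].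
intros x _; apply continuity_pt_filterlim, (ex_derive_continuous f x).
exists 0; auto.
Qed.

(** Both [g - f] and [g + f] are nondecreasing and vanish at [0]; the absolute value of [g] serves
    negative times, where both are nonpositive. *)
Lemma derive_dominated (f g df dg : R -> R) :
  (forall t, is_derive f t (df t)) -> (forall t, is_derive g t (dg t)) ->
  (forall t, Rabs (df t) <= dg t) -> f 0 = 0 -> g 0 = 0 ->
  forall t, Rabs (f t) <= Rabs (g t).
Proof.
intros hf hg hd f0 g0 t.
assert (hd' : forall x, 0 <= dg x - df x /\ 0 <= dg x + df x).
{ intros x; generalize (hd x) (Rle_abs (df x)) (Rle_abs (- df x)).
  rewrite Rabs_Ropp; lra. }
assert (hm : forall x, is_derive (fun y => g y - f y) x (dg x - df x))
  by (intros x; apply (is_derive_minus g f); auto).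
assert (hp : forall x, is_derive (fun y => g y + f y) x (dg x + df x))
  by (intros x; apply (is_derive_plus g f); auto).
destruct (Rle_dec 0 t) as [ht|ht].
- generalize (derive_nonneg_le _ _ 0 t ht (fun x _ => hm x)
    (fun x _ => proj1 (hd' x))).
  generalize (derive_nonneg_le _ _ 0 t ht (fun x _ => hp x)
    (fun x _ => proj2 (hd' x))).
  rewrite f0, g0; intros; unfold Rabs; repeat destruct Rcase_abs; lra.
- assert (ht' : t <= 0) by lra.
  generalize (derive_nonneg_le _ _ t 0 ht' (fun x _ => hm x)
    (fun x _ => proj1 (hd' x))).
  generalize (derive_nonneg_le _ _ t 0 ht' (fun x _ => hp x)
    (fun x _ => proj2 (hd' x))).
  rewrite f0, g0; intros; unfold Rabs; repeat destruct Rcase_abs; lra.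
Qed.

Lemma is_derive_primitive (f : R -> R) (t : R) :
  (forall x, continuous f x) -> is_derive (fun y => RInt f 0 y) t (f t).
Proof.
intros hf; apply (is_derive_RInt f _ 0); [|apply hf].
apply filter_forall; intros y; apply (RInt_correct f).
apply (ex_RInt_continuous f); intros z _; apply hf.
Qed.

Section Picard.

Variables (F : R -> R -> R) (M y0 : R).
Hypothesis M_ge1 : 1 <= M.
Hypothesis F_bound : forall t y, Rabs (F t y) <= M.
Hypothesis F_lip : forall t y z, Rabs (F t y - F t z) <= M * Rabs (y - z).
Hypothesis F_cont : forall f : R -> R, (forall t : R, continuous f t) ->
  forall t : R, continuous (fun r => F r (f r)) t.

Definition picard (f : R -> R) (t : R) : R := y0 + RInt (fun r => F r (f r)) 0 t.

Fixpoint picard_iter (n : nat) : R -> R :=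
  match n with 0%nat => fun _ => y0 | S n => picard (picard_iter n) end.

(** A Bielecki weight: integrating it from [0] gains a factor [1 / (2 M)], so the Lipschitz constant
    [M] becomes a contraction factor [1/2] on the whole line at once, in both time directions. *)
Definition picard_weight (t : R) : R := exp (2 * M * t) + exp (- (2 * M * t)).

(** The limit of the iterates as a telescoping series, so that convergence and the error bound both
    follow from termwise comparison with a geometric series. *)
Definition picard_limit (t : R) : R :=
  y0 + Series (fun n => picard_iter (S n) t - picard_iter n t).

Lemma is_derive_picard (f : R -> R) (t : R) : (forall r : R, continuous f r) ->
  is_derive (picard f) t (F t (f t)).
Proof.
intros hf; unfold picard.
replace (F t (f t)) with (plus 0 (F t (f t))) by (apply Rplus_0_l).
apply (is_derive_plus (fun _ => y0) (fun t => RInt (fun r => F r (f r)) 0 t)).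
- apply (is_derive_const y0).
- apply (is_derive_primitive (fun r => F r (f r))); intros x; now apply F_cont.
Qed.

Lemma continuous_picard (f : R -> R) : (forall t : R, continuous f t) ->
  forall t : R, continuous (picard f) t.
Proof.
intros hf t; apply (ex_derive_continuous (picard f)).
eexists; now apply is_derive_picard.
Qed.

Lemma continuous_picard_iter (n : nat) (t : R) : continuous (picard_iter n) t.
Proof.
revert t; induction n as [|n IH]; [intros t; apply continuous_const|].
now apply continuous_picard.
Qed.

Lemma picard_weight_ge t : 2 <= picard_weight t.
Proof.
unfold picard_weight; set (x := 2 * M * t).
generalize (exp_ineq1_le x) (exp_ineq1_le (- x)); lra.
Qed.

Lemma picard_weight_dominates (f df : R -> R) (C : R) :
  0 <= C -> f 0 = 0 -> (forall t, is_derive f t (df t)) ->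
  (forall t, Rabs (df t) <= M * C * picard_weight t) ->
  forall t, Rabs (f t) <= C / 2 * picard_weight t.
Proof.
intros hC f0 hf hd t.
eapply Rle_trans.
- apply (derive_dominated f
    (fun t => C / 2 * (exp (2 * M * t) - exp (- (2 * M * t)))) df
    (fun t => M * C * picard_weight t)); auto.
  + intros r; unfold picard_weight; auto_derive; [easy|field].
  + rewrite Rmult_0_r, Ropp_0; ring.
- rewrite Rabs_mult, (Rabs_right (C / 2)) by lra.
  apply Rmult_le_compat_l; [lra|]; unfold picard_weight.
  assert (h := exp_pos (2 * M * t)); assert (h' := exp_pos (- (2 * M * t))).
  unfold Rabs; destruct Rcase_abs; lra.
Qed.

Lemma picard_contracts (f g : R -> R) (C : R) :
  0 <= C -> (forall t : R, continuous f t) -> (forall t : R, continuous g t) ->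
  (forall t, Rabs (f t - g t) <= C * picard_weight t) ->
  forall t, Rabs (picard f t - picard g t) <= C / 2 * picard_weight t.
Proof.
intros hC hf hg hfg.
apply picard_weight_dominates with (df := fun t => F t (f t) - F t (g t)).
- easy.
- unfold picard; rewrite !RInt_point; apply Rminus_diag.
- intros t; apply (is_derive_minus (picard f) (picard g));
    now apply is_derive_picard.
- intros t; eapply Rle_trans; [apply F_lip|].
  rewrite Rmult_assoc; apply Rmult_le_compat_l; [lra|apply hfg].
Qed.

Lemma picard_iter_step n t :
  Rabs (picard_iter (S n) t - picard_iter n t) <= M * (1 / 2) ^ n * picard_weight t.
Proof.
revert t; induction n as [|n IH]; intros t.
- assert (h : Rabs (picard (fun _ => y0) t - y0) <= M / 2 * picard_weight t).
  { apply picard_weight_dominates with (f := fun t => picard (fun _ => y0) t - y0)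
      (df := fun t => F t y0 - 0).
    + lra.
    + unfold picard; rewrite RInt_point; unfold zero; simpl; ring.
    + intros r; apply (is_derive_minus (picard (fun _ => y0)) (fun _ => y0)).
      * apply (is_derive_picard (fun _ => y0)); intros; apply continuous_const.
      * apply (is_derive_const y0).
    + intros r; rewrite Rminus_0_r; eapply Rle_trans; [apply F_bound|].
      assert (h := picard_weight_ge r); nra. }
  assert (h' := picard_weight_ge t); simpl; nra.
- replace (M * (1 / 2) ^ S n) with (M * (1 / 2) ^ n / 2) by (simpl; field).
  apply (picard_contracts (picard_iter (S n)) (picard_iter n)); try easy.
  + apply Rmult_le_pos; [lra|apply pow_le; lra].
  + apply continuous_picard_iter.
  + apply continuous_picard_iter.
Qed.

Lemma picard_iter_sum n t :
  y0 + sum_n (fun n => picard_iter (S n) t - picard_iter n t) n = picard_iter (S n) t.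
Proof.
induction n as [|n IH].
- rewrite sum_O; simpl; ring.
- rewrite sum_Sn; unfold plus; simpl in *; lra.
Qed.

Lemma is_lim_picard_geom K : is_lim_seq (fun n => K * (1 / 2) ^ n) 0.
Proof.
replace (Finite 0) with (Rbar_mult K 0) by (simpl; now rewrite Rmult_0_r).
apply is_lim_seq_scal_l, is_lim_seq_geom; rewrite Rabs_right; lra.
Qed.

Lemma picard_limit_bound n t :
  Rabs (picard_limit t - picard_iter n t) <= 2 * M * (1 / 2) ^ n * picard_weight t.
Proof.
set (d := fun k => picard_iter (S k) t - picard_iter k t).
set (g := fun k => M * (1 / 2) ^ k * picard_weight t).
assert (hg : forall m, is_series (fun k => g (m + k)%nat)
    (2 * M * (1 / 2) ^ m * picard_weight t)).
{ intros m.
  apply is_series_ext with (fun k => scal (M * picard_weight t * (1/2)^m) ((1/2)^k)).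
  - intros k; unfold g, scal; simpl; unfold mult; simpl; rewrite pow_add; ring.
  - replace (2 * M * (1 / 2) ^ m * picard_weight t)
      with (scal (M * picard_weight t * (1/2)^m) (/ (1 - 1/2)))
      by (change (M * picard_weight t * (1/2)^m * / (1 - 1/2)
            = 2 * M * (1 / 2) ^ m * picard_weight t); field).
    apply (is_series_scal (K := R_AbsRing) (V := R_NormedModule)), is_series_geom.
    rewrite Rabs_right; lra. }
assert (hle : forall k, Rabs (d k) <= g k)
  by exact (fun k => picard_iter_step k t).
assert (hd : ex_series (fun k => Rabs (d k))).
{ apply (ex_series_le (fun k => Rabs (d k)) g).
  - intros k; unfold norm; simpl; unfold abs; simpl; rewrite Rabs_Rabsolu; apply hle.
  - exists (2 * M * (1 / 2) ^ 0 * picard_weight t); apply (hg 0%nat). }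
assert (tail : picard_limit t - picard_iter n t = Series (fun k => d (n + k)%nat)).
{ unfold picard_limit; fold d; destruct n as [|n].
  - simpl; ring_simplify; now apply Series_ext.
  - rewrite (Series_incr_n d (S n)); [|lia|now apply ex_series_Rabs].
    rewrite <- picard_iter_sum, <- sum_n_Reals; simpl pred; fold d; ring. }
rewrite tail, <- (is_series_unique _ _ (hg n)).
assert (hdn : ex_series (fun k => Rabs (d (n + k)%nat)))
  by now apply (ex_series_incr_n (fun k => Rabs (d k))).
eapply Rle_trans; [now apply Series_Rabs|].
apply Series_le.
- intros k; split; [apply Rabs_pos|apply hle].
- eexists; apply hg.
Qed.

Lemma continuous_picard_limit (t : R) : continuous picard_limit t.
Proof.
assert (hr : 0 < Rabs t + 1) by (generalize (Rabs_pos t); lra).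
apply continuity_pt_filterlim.
apply (CVU_continuity picard_iter picard_limit 0 (mkposreal _ hr)).
- intros eps heps.
  (* On the ball of radius [Rabs t + 1] the weight is at most [2 exp (2 M (Rabs t + 1))], which
     turns the pointwise error bound into a uniform one; [4 M] is [2 M] times this [2]. *)
  destruct (proj2 (is_lim_seq_spec _ _)
    (is_lim_picard_geom (4 * M * exp (2 * M * (Rabs t + 1)))) (mkposreal eps heps))
    as [N hN].
  exists N; intros n y hn hy; unfold Boule in hy; simpl in hy, hN.
  eapply Rle_lt_trans; [apply picard_limit_bound|].
  specialize (hN n hn); rewrite Rminus_0_r in hN.
  eapply Rle_lt_trans; [|eapply Rle_lt_trans; [apply Rle_abs|apply hN]].
  assert (picard_weight y <= 2 * exp (2 * M * (Rabs t + 1))).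
  { rewrite Rminus_0_r in hy; apply Rabs_def2 in hy; unfold picard_weight.
    assert (exp (2 * M * y) <= exp (2 * M * (Rabs t + 1)))
      by (left; apply exp_increasing; nra).
    assert (exp (- (2 * M * y)) <= exp (2 * M * (Rabs t + 1)))
      by (left; apply exp_increasing; nra).
    lra. }
  assert (0 <= 2 * M * (1/2)^n) by (apply Rmult_le_pos; [lra|apply pow_le; lra]).
  nra.
- intros n y _; apply continuity_pt_filterlim, continuous_picard_iter.
- unfold Boule; simpl; rewrite Rminus_0_r; lra.
Qed.

Lemma picard_limit_fixed t : picard_limit t = picard picard_limit t.
Proof.
assert (h : forall n, Rabs (picard_limit t - picard picard_limit t)
  <= 3 * M * picard_weight t * (1/2) ^ n).
{ intros n.
  assert (h1 := picard_limit_bound (S n) t).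
  assert (h2 := picard_contracts picard_limit (picard_iter n)
    (2 * M * (1/2)^n)).
  specialize (h2 ltac:(apply Rmult_le_pos; [lra|apply pow_le; lra])
    continuous_picard_limit (continuous_picard_iter n)
    (picard_limit_bound n) t).
  simpl picard_iter in h1.
  replace (picard_limit t - picard picard_limit t) with
   ((picard_limit t - picard (picard_iter n) t)
     - (picard picard_limit t - picard (picard_iter n) t)) by ring.
  eapply Rle_trans; [apply Rabs_triang|]; rewrite Rabs_Ropp.
  assert (0 <= picard_weight t) by (generalize (picard_weight_ge t); lra).
  assert (0 <= (1/2)^n) by (apply pow_le; lra).
  assert (0 <= M * (1/2)^n * picard_weight t) by (repeat apply Rmult_le_pos; lra).
  simpl pow in h1; lra. }
apply Rminus_diag_uniq, Rabs_eq_0.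
apply Rle_antisym; [|apply Rabs_pos].
apply (is_lim_seq_le (fun _ => Rabs (picard_limit t - picard picard_limit t))
  (fun n => 3 * M * picard_weight t * (1/2) ^ n)
  (Rabs (picard_limit t - picard picard_limit t)) 0 h).
- apply is_lim_seq_const.
- apply is_lim_picard_geom.
Qed.

(** Stated as a [sig] so that the angle at [pi/2] can later be a function of the parameter [s]. *)
Lemma picard_exists :
  {y : R -> R | y 0 = y0 /\ forall t, is_derive y t (F t (y t))}.
Proof.
exists picard_limit; split.
- rewrite picard_limit_fixed; unfold picard; rewrite RInt_point.
  unfold zero; simpl; ring.
- intros t; apply is_derive_ext with (picard picard_limit).
  + intros r; symmetry; apply picard_limit_fixed.
  + apply is_derive_picard, continuous_picard_limit.
Qed.

End Picard.

(** * Polar angles *)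

Lemma is_derive_continuous (f : R -> R) (t df : R) :
  is_derive f t df -> continuous f t.
Proof. intros h; apply (ex_derive_continuous f); now exists df. Qed.

Lemma is_derive_eq (f : R -> R) (t df df' : R) :
  is_derive f t df -> df = df' -> is_derive f t df'.
Proof. now intros h <-. Qed.

(** Squaring makes the negative part differentiable at [0], so the Gronwall argument below needs no
    discussion of sign changes. *)
Lemma derive_neg_part_sq (x : R) :
  is_derive (fun y => Rmin y 0 ^ 2) x (2 * Rmin x 0).
Proof.
destruct (Rtotal_order x 0) as [hx|[->|hx]].
- apply is_derive_ext_loc with (fun y => y ^ 2).
  + apply (locally_interval _ x m_infty 0); simpl; auto.
    intros y _ hy; rewrite Rmin_left; lra.
  + rewrite Rmin_left by lra; auto_derive; [easy|ring].
- rewrite Rmin_left, Rmult_0_r by lra.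
  apply is_derive_Reals; intros eps heps.
  exists (mkposreal eps heps); simpl; intros h hh hl.
  rewrite Rplus_0_l, (Rmin_left 0 0) by lra.
  replace (_ / h - 0) with (Rmin h 0 ^ 2 / h) by (field; auto).
  apply Rle_lt_trans with (Rabs h); [|easy].
  destruct (Rle_dec h 0).
  + rewrite Rmin_left by lra; replace (h ^ 2 / h) with h by (field; auto); lra.
  + rewrite Rmin_right by lra; replace (0 ^ 2 / h) with 0 by (field; auto).
    rewrite Rabs_R0; apply Rabs_pos.
- apply is_derive_ext_loc with (fun _ => 0).
  + apply (locally_interval _ x 0 p_infty); simpl; auto.
    intros y hy _; rewrite Rmin_right; lra.
  + rewrite Rmin_right by lra; rewrite Rmult_0_r; apply (is_derive_const 0).
Qed.

(** Where [f < 0] the hypothesis reads [L f <= f'], hence [exp (-2 L t) min(f, 0)^2] is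
    nonincreasing; it vanishes at [0], so it vanishes at [T]. The rate is [2 L] because of the
    square. *)
Lemma derive_ge_nonneg (f df : R -> R) (L T : R) :
  0 <= T -> 0 <= f 0 ->
  (forall t, 0 <= t <= T -> is_derive f t (df t)) ->
  (forall t, 0 <= t <= T -> - (L * Rabs (f t)) <= df t) ->
  0 <= f T.
Proof.
intros hT h0 hf hd.
set (g := fun t => - (exp (- (2 * L * t)) * Rmin (f t) 0 ^ 2)).
assert (hg : g 0 <= g T).
{ apply derive_nonneg_le with (df := fun t =>
    exp (- (2 * L * t)) * (2 * L * Rmin (f t) 0 ^ 2 - 2 * Rmin (f t) 0 * df t)).
  - easy.
  - intros t ht; unfold g.
    eapply is_derive_eq.
    + apply (is_derive_opp (fun t => exp (- (2 * L * t)) * Rmin (f t) 0 ^ 2)).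
      apply (is_derive_mult (fun t => exp (- (2 * L * t))) (fun t => Rmin (f t) 0 ^ 2)).
      * auto_derive; [easy|reflexivity].
      * apply (is_derive_comp (fun y => Rmin y 0 ^ 2) f).
        -- apply derive_neg_part_sq.
        -- now apply hf.
      * intros; apply Rmult_comm.
    + unfold opp, plus, mult, scal; simpl; unfold mult; simpl; ring.
  - intros t ht; apply Rmult_le_pos; [left; apply exp_pos|].
    specialize (hd t ht); unfold Rabs in hd.
    unfold Rmin; destruct Rle_dec; [|lra].
    destruct Rcase_abs; [|replace (f t) with 0 by lra; lra].
    nra. }
unfold g in hg; rewrite (Rmin_right (f 0)) in hg by easy.
destruct (Rle_dec 0 (f T)) as [h|h]; [easy|].
rewrite Rmin_left in hg by lra.
assert (0 < exp (- (2 * L * T)) * f T ^ 2)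
  by (apply Rmult_lt_0_compat; [apply exp_pos|nra]).
lra.
Qed.

Lemma sin_abs_le (x : R) : Rabs (sin x) <= Rabs x.
Proof.
apply (derive_dominated sin (fun x => x) cos (fun _ => 1)).
- intros t; apply is_derive_sin.
- intros t; apply (is_derive_id t).
- intros t; apply Rabs_le, COS_bound.
- apply sin_0.
- easy.
Qed.

Lemma cos_sq_sin_sq (x : R) : cos x ^ 2 = 1 - sin x ^ 2.
Proof. generalize (sin2_cos2 x); unfold Rsqr; lra. Qed.

Lemma sin_sq_lip (x y : R) : Rabs (sin x ^ 2 - sin y ^ 2) <= Rabs (x - y).
Proof.
replace (sin x ^ 2 - sin y ^ 2) with (sin (x - y) * sin (x + y)).
- rewrite Rabs_mult.
  assert (h1 := sin_abs_le (x - y)).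
  assert (h2 : Rabs (sin (x + y)) <= 1) by apply Rabs_le, SIN_bound.
  generalize (Rabs_pos (sin (x - y))) (Rabs_pos (sin (x + y))); nra.
- rewrite sin_minus, sin_plus.
  generalize (cos_sq_sin_sq x) (cos_sq_sin_sq y); intros hx hy.
  transitivity (sin x ^ 2 * cos y ^ 2 - cos x ^ 2 * sin y ^ 2); [ring|].
  rewrite hx, hy; ring.
Qed.

(** The velocity is a separate function, so that the equation is a first-order system of [is_derive]
    facts free of differentiability side conditions. *)
Definition hill_solution (p x dx : R -> R) : Prop :=
  forall t, is_derive x t (dx t) /\ is_derive dx t (- (p t * x t)).

(* Polar angle of a nonzero solution in the phase plane: [x = r cos phi] and
   [x' = - r sin phi]. *)
Definition is_phase (p phi : R -> R) : Prop :=
  forall t, is_derive phi t (sin (phi t) ^ 2 + p t * cos (phi t) ^ 2).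

Lemma phase_exists (p : R -> R) (P phi0 : R) :
  (forall t, continuous p t) -> (forall t, Rabs (p t) <= P) ->
  {phi | phi 0 = phi0 /\ is_phase p phi}.
Proof.
intros hc hP.
assert (hP0 : 0 <= P) by (eapply Rle_trans; [apply Rabs_pos|apply (hP 0)]).
(* Since the field equals [p + (1 - p) sin^2 y], the number [1 + P] serves both as a bound and as a
   Lipschitz constant. *)
apply (picard_exists (fun t y => sin y ^ 2 + p t * cos y ^ 2) (1 + P) phi0).
- lra.
- intros t y; rewrite cos_sq_sin_sq.
  assert (hs : 0 <= sin y ^ 2 <= 1)
    by (generalize (cos_sq_sin_sq y) (pow2_ge_0 (sin y)) (pow2_ge_0 (cos y)); lra).
  specialize (hP t); apply Rabs_le_between in hP; apply Rabs_le; nra.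
- intros t y z; rewrite !cos_sq_sin_sq.
  replace (_ - _) with ((1 - p t) * (sin y ^ 2 - sin z ^ 2)) by ring.
  rewrite Rabs_mult; apply Rmult_le_compat; try apply Rabs_pos.
  + specialize (hP t); apply Rabs_le_between in hP; apply Rabs_le; lra.
  + apply sin_sq_lip.
- intros f hf t.
  apply (continuous_plus (fun r => sin (f r) ^ 2) (fun r => p r * cos (f r) ^ 2)).
  + apply (continuous_comp f (fun y => sin y ^ 2)); [apply hf|].
    apply (ex_derive_continuous (fun y => sin y ^ 2)); auto_derive; easy.
  + apply (continuous_mult p (fun r => cos (f r) ^ 2)); [apply hc|].
    apply (continuous_comp f (fun y => cos y ^ 2)); [apply hf|].
    apply (ex_derive_continuous (fun y => cos y ^ 2)); auto_derive; easy.
Qed.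

(** Requiring [(rho cos phi)' = - rho sin phi] forces [rho' = (p - 1) sin phi cos phi rho], a linear
    equation solved by an exponential, which also keeps [rho] positive. *)
Lemma phase_hill (p phi : R -> R) :
  (forall t, continuous p t) -> is_phase p phi ->
  exists rho : R -> R, rho 0 = 1 /\ (forall t, 0 < rho t) /\
    hill_solution p (fun t => rho t * cos (phi t)) (fun t => - (rho t * sin (phi t))).
Proof.
intros hc hphi.
set (k := fun t => (p t - 1) * (sin (phi t) * cos (phi t))).
assert (hk : forall t, continuous k t).
{ intros t; apply (continuous_mult (fun t => p t - 1) (fun t => sin (phi t) * cos (phi t))).
  - apply (continuous_minus p (fun _ => 1)); [apply hc|apply continuous_const].
  - apply (continuous_comp phi (fun y => sin y * cos y)).
    + eapply is_derive_continuous, hphi.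
    + apply (ex_derive_continuous (fun y => sin y * cos y)); auto_derive; easy. }
set (rho := fun t => exp (RInt k 0 t)).
assert (hrho : forall t, is_derive rho t (k t * rho t)).
{ intros t; apply (is_derive_comp exp (fun t => RInt k 0 t)).
  - apply is_derive_exp.
  - apply (is_derive_primitive k t hk). }
assert (hcos : forall t, is_derive (fun t => cos (phi t)) t
   (- sin (phi t) * (sin (phi t) ^ 2 + p t * cos (phi t) ^ 2))).
{ intros t; eapply is_derive_eq.
  - apply (is_derive_comp cos phi); [apply is_derive_cos|apply hphi].
  - unfold scal; simpl; unfold mult; simpl; ring. }
assert (hsin : forall t, is_derive (fun t => sin (phi t)) t
   (cos (phi t) * (sin (phi t) ^ 2 + p t * cos (phi t) ^ 2))).
{ intros t; eapply is_derive_eq.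
  - apply (is_derive_comp sin phi); [apply is_derive_sin|apply hphi].
  - unfold scal; simpl; unfold mult; simpl; ring. }
exists rho; split; [|split].
- unfold rho; rewrite RInt_point; apply exp_0.
- intros t; apply exp_pos.
- intros t; assert (e := cos_sq_sin_sq (phi t)); split.
  + eapply is_derive_eq.
    * apply (is_derive_mult rho (fun t => cos (phi t)));
        [apply hrho|apply hcos|intros; apply Rmult_comm].
    * unfold plus, mult; simpl; unfold k.
      transitivity (rho t * sin (phi t)
        * ((p t - 1) * cos (phi t) ^ 2 - sin (phi t) ^ 2 - p t * cos (phi t) ^ 2));
        [ring|rewrite e; ring].
  + eapply is_derive_eq.
    * apply (is_derive_opp (fun t => rho t * sin (phi t))).
      apply (is_derive_mult rho (fun t => sin (phi t)));
        [apply hrho|apply hsin|intros; apply Rmult_comm].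
    * unfold opp, plus, mult; simpl; unfold k.
      transitivity (- (rho t * cos (phi t)
        * ((p t - 1) * sin (phi t) ^ 2 + sin (phi t) ^ 2 + p t * cos (phi t) ^ 2)));
        [ring|rewrite e; ring].
Qed.

(** * Sturm comparison of polar angles *)

Section PhaseComparison.

Variables (p1 p2 phi1 phi2 : R -> R) (L T : R).
Hypothesis hphi1 : is_phase p1 phi1.
Hypothesis hphi2 : is_phase p2 phi2.
Hypothesis hphi0 : phi1 0 = phi2 0.
Hypothesis hle : forall t, 0 <= t <= T -> p1 t <= p2 t.
Hypothesis hL : forall t, 0 <= t <= T -> Rabs (1 - p2 t) <= L.

(** The derivative of [phi2 - phi1], split into a term that is Lipschitz in [phi2 - phi1] and a
    nonnegative forcing by [p2 - p1]. *)
Let d t := (1 - p2 t) * (sin (phi2 t) ^ 2 - sin (phi1 t) ^ 2)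
  + (p2 t - p1 t) * cos (phi1 t) ^ 2.

Lemma phase_diff_derive t : is_derive (fun t => phi2 t - phi1 t) t (d t).
Proof.
eapply is_derive_eq.
- apply (is_derive_minus phi2 phi1); [apply hphi2|apply hphi1].
- unfold minus, plus, opp, d; cbn -[pow]; rewrite !cos_sq_sin_sq; ring.
Qed.

Lemma phase_diff_lip t : 0 <= t <= T ->
  Rabs ((1 - p2 t) * (sin (phi2 t) ^ 2 - sin (phi1 t) ^ 2)) <= L * Rabs (phi2 t - phi1 t).
Proof.
intros ht; rewrite Rabs_mult.
apply Rmult_le_compat; try apply Rabs_pos; [now apply hL|apply sin_sq_lip].
Qed.

Lemma phase_le t : 0 <= t <= T -> phi1 t <= phi2 t.
Proof.
intros ht.
enough (0 <= phi2 t - phi1 t) by lra.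
apply (derive_ge_nonneg (fun t => phi2 t - phi1 t) d L t); [lra|lra| |].
- intros r _; apply phase_diff_derive.
- intros r hr; assert (h := phase_diff_lip r ltac:(lra)).
  apply Rabs_le_between in h; unfold d.
  assert (h1 := hle r ltac:(lra)); assert (h2 := pow2_ge_0 (cos (phi1 r))).
  nra.
Qed.

(** Gronwall: [exp (- L t) (phi2 - phi1 + G)] is nonincreasing, because for [1 <= L] the summand [G]
    absorbs the forcing. *)
Lemma phase_diff_upper (G : R) : 0 <= T -> 1 <= L ->
  (forall t, 0 <= t <= T -> p2 t - p1 t <= G) ->
  phi2 T - phi1 T <= G * exp (L * T).
Proof.
intros hT hL1 hG.
set (g := fun t => - (exp (- (L * t)) * (phi2 t - phi1 t + G))).
assert (hg : g 0 <= g T).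
{ apply derive_nonneg_le with (df := fun t =>
    exp (- (L * t)) * (L * (phi2 t - phi1 t + G) - d t)).
  - easy.
  - intros t ht; unfold g; eapply is_derive_eq.
    + apply (is_derive_opp (fun t => exp (- (L * t)) * (phi2 t - phi1 t + G))).
      apply (is_derive_mult (fun t => exp (- (L * t))) (fun t => phi2 t - phi1 t + G)).
      * auto_derive; [easy|reflexivity].
      * apply (is_derive_plus (fun t => phi2 t - phi1 t) (fun _ => G)).
        -- apply phase_diff_derive.
        -- apply (is_derive_const G).
      * intros; apply Rmult_comm.
    + unfold opp, plus, mult, zero; simpl; ring.
  - intros t ht; apply Rmult_le_pos; [left; apply exp_pos|].
    assert (h := phase_diff_lip t ht); assert (h0 := phase_le t ht).
    rewrite (Rabs_right (phi2 t - phi1 t)) in h by lra.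
    apply Rabs_le_between in h; unfold d.
    assert (h1 := hle t ht); assert (h2 := pow2_ge_0 (cos (phi1 t))).
    assert (h3 := cos_sq_sin_sq (phi1 t)); assert (h4 := pow2_ge_0 (sin (phi1 t))).
    assert (h5 := hG t ht).
    assert ((p2 t - p1 t) * cos (phi1 t) ^ 2 <= G) by nra.
    nra. }
unfold g in hg; rewrite Rmult_0_r, Ropp_0, exp_0, hphi0 in hg.
assert (h := exp_pos (L * T)).
assert (e : exp (L * T) * exp (- (L * T)) = 1)
  by (rewrite <- exp_plus, Rplus_opp_r; apply exp_0).
assert (h0 := hG 0 ltac:(lra)); assert (h1 := hle 0 ltac:(lra)).
assert (exp (L * T) * (exp (- (L * T)) * (phi2 T - phi1 T + G)) <= exp (L * T) * G)
  by (apply Rmult_le_compat_l; lra).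
replace (exp (L * T) * (exp (- (L * T)) * (phi2 T - phi1 T + G)))
  with (phi2 T - phi1 T + G) in H by (rewrite <- Rmult_assoc, e; ring).
lra.
Qed.

(** Equality at [T] would propagate back to all of [[0, T]]. The forcing then vanishes, so
    [cos phi1 = 0] throughout; but an angle crosses the zeros of [cos] with speed [1] and cannot
    stay there. *)
Lemma phase_lt : 0 < T -> (forall t, 0 < t < T -> p1 t < p2 t) -> phi1 T < phi2 T.
Proof.
intros hT hlt.
destruct (Rle_lt_or_eq_dec _ _ (phase_le T ltac:(lra))) as [h|hTe]; [easy|exfalso].
(* [exp (L t) (phi2 t - phi1 t)] is nondecreasing. *)
assert (heq : forall t, 0 <= t <= T -> phi1 t = phi2 t).
{ intros t ht; apply Rle_antisym; [now apply phase_le|].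
  set (g := fun t => exp (L * t) * (phi2 t - phi1 t)).
  assert (hg : g t <= g T).
  { apply derive_nonneg_le with (df := fun t =>
      exp (L * t) * (L * (phi2 t - phi1 t) + d t)).
    - easy.
    - intros r hr; unfold g; eapply is_derive_eq.
      + apply (is_derive_mult (fun t => exp (L * t)) (fun t => phi2 t - phi1 t)).
        * auto_derive; [easy|reflexivity].
        * apply phase_diff_derive.
        * intros; apply Rmult_comm.
      + unfold plus, mult; simpl; ring.
    - intros r hr; apply Rmult_le_pos; [left; apply exp_pos|].
      assert (hr' : 0 <= r <= T) by lra.
      assert (h := phase_diff_lip r hr'); assert (h0 := phase_le r hr').
      rewrite (Rabs_right (phi2 r - phi1 r)) in h by lra.
      apply Rabs_le_between in h; unfold d.
      assert (h1 := hle r hr'); assert (h2 := pow2_ge_0 (cos (phi1 r))).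
      nra. }
  unfold g in hg; rewrite hTe, Rminus_diag, Rmult_0_r in hg.
  assert (h := exp_pos (L * t)); nra. }
assert (hcos : forall t, 0 < t < T -> cos (phi1 t) = 0).
{ intros t ht.
  assert (h0 : is_derive (fun t => phi2 t - phi1 t) t 0).
  { apply is_derive_ext_loc with (fun _ => 0); [|apply (is_derive_const 0)].
    apply (locally_interval _ t 0 T); simpl; try lra.
    intros r h1 h2; rewrite heq by lra; ring. }
  assert (e : d t = 0).
  { rewrite <- (is_derive_unique _ _ _ (phase_diff_derive t)).
    now apply is_derive_unique. }
  unfold d in e; rewrite heq in e by lra; rewrite <- heq in e by lra.
  assert (h := hlt t ht).
  assert (e' : (p2 t - p1 t) * cos (phi1 t) ^ 2 = 0) by (rewrite heq in *; lra).
  apply Rmult_integral in e'; destruct e' as [e'|e']; [lra|].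
  simpl in e'; rewrite Rmult_1_r in e'; now apply Rsqr_0_uniq. }
set (t := T / 2).
assert (ht : 0 < t < T) by (unfold t; lra).
assert (h0 : is_derive (fun t => cos (phi1 t)) t 0).
{ apply is_derive_ext_loc with (fun _ => 0); [|apply (is_derive_const 0)].
  apply (locally_interval _ t 0 T); simpl; try apply ht.
  intros r h1 h2; symmetry; apply hcos; lra. }
assert (h1 : is_derive (fun t => cos (phi1 t)) t
   (- sin (phi1 t) * (sin (phi1 t) ^ 2 + p1 t * cos (phi1 t) ^ 2))).
{ eapply is_derive_eq.
  - apply (is_derive_comp cos phi1); [apply is_derive_cos|apply hphi1].
  - unfold scal; simpl; unfold mult; simpl; ring. }
assert (e := is_derive_unique _ _ _ h0).
rewrite (is_derive_unique _ _ _ h1), hcos in e by easy.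
assert (e' := cos_sq_sin_sq (phi1 t)); rewrite hcos in e' by easy.
assert (hs : sin (phi1 t) ^ 2 = 1) by lra.
rewrite hs in e; assert (hs0 : sin (phi1 t) = 0) by lra.
rewrite hs0 in hs; lra.
Qed.

End PhaseComparison.

(** * Non-coexistence *)

Lemma three_term_zero (s : R) (w a : Z -> R) (k : Z) :
  s <> 0 -> (forall k, w k * a k = s * (a (k + 1)%Z + a (k - 1)%Z)) ->
  a k = 0 -> a (k + 1)%Z = 0 -> forall m, a m = 0.
Proof.
intros hs hrec h0 h1 m.
assert (hup : forall n : nat, a (k + Z.of_nat n)%Z = 0 /\ a (k + Z.of_nat n + 1)%Z = 0).
{ induction n as [|n [IH0 IH1]].
  - now rewrite Z.add_0_r.
  - rewrite Nat2Z.inj_succ; unfold Z.succ; rewrite Z.add_assoc; split; [easy|].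
    assert (e := hrec (k + Z.of_nat n + 1)%Z).
    replace (k + Z.of_nat n + 1 - 1)%Z with (k + Z.of_nat n)%Z in e by lia.
    rewrite IH0, IH1, Rmult_0_r, Rplus_0_r in e.
    now apply eq_sym, Rmult_integral in e; destruct e. }
assert (hdown : forall n : nat, a (k - Z.of_nat n)%Z = 0 /\ a (k - Z.of_nat n + 1)%Z = 0).
{ induction n as [|n [IH0 IH1]].
  - now rewrite Z.sub_0_r.
  - rewrite Nat2Z.inj_succ.
    replace (k - Z.succ (Z.of_nat n) + 1)%Z with (k - Z.of_nat n)%Z by lia.
    split; [|easy].
    assert (e := hrec (k - Z.of_nat n)%Z).
    replace (k - Z.of_nat n - 1)%Z with (k - Z.succ (Z.of_nat n))%Z in e by lia.
    rewrite IH0, IH1, Rmult_0_r, Rplus_0_l in e.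
    now apply eq_sym, Rmult_integral in e; destruct e. }
destruct (Z_le_gt_dec k m).
- replace m with (k + Z.of_nat (Z.to_nat (m - k)))%Z by lia; apply hup.
- replace m with (k - Z.of_nat (Z.to_nat (k - m)))%Z by lia; apply hdown.
Qed.

(* The Casoratian of two solutions is constant, and it tends to [0] because [w]
   is unbounded. *)
Lemma three_term_dependent (s C : R) (w a b : Z -> R) :
  s <> 0 -> (forall k, w k * a k = s * (a (k + 1)%Z + a (k - 1)%Z)) ->
  (forall k, w k * b k = s * (b (k + 1)%Z + b (k - 1)%Z)) ->
  (forall k, Rabs (a k) <= C) -> (forall k, Rabs (b k) <= C) ->
  (forall A : R, exists k : Z, A <= w k) ->
  a 0%Z * b 1%Z = a 1%Z * b 0%Z.
Proof.
intros hs ha hb hCa hCb hw.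
set (D := fun k => a k * b (k + 1)%Z - a (k + 1)%Z * b k).
assert (hstep : forall k, D k = D (k - 1)%Z).
{ intros k; unfold D; replace (k - 1 + 1)%Z with k by lia.
  apply (Rmult_eq_reg_l s); [|easy].
  assert (e : w k * a k * b k = w k * b k * a k) by ring.
  rewrite ha, hb in e; lra. }
assert (hconst : forall k, D k = D 0%Z).
{ intros k; pattern k; apply Z.bi_induction.
  - intros x y ->; tauto.
  - easy.
  - intros m; rewrite (hstep (Z.succ m)); replace (Z.succ m - 1)%Z with m by lia; tauto. }
assert (hC : 0 <= C) by (eapply Rle_trans; [apply Rabs_pos|apply (hCa 0%Z)]).
(* Multiplying by [w k] and substituting both recurrences removes [w], leaving only products of
   bounded coefficients. *)
assert (hbound : forall k, Rabs (w k * D k) <= 4 * (Rabs s * C * C)).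
{ intros k; unfold D.
  replace (w k * (a k * b (k + 1)%Z - a (k + 1)%Z * b k))
    with ((w k * a k) * b (k + 1)%Z - (w k * b k) * a (k + 1)%Z) by ring.
  rewrite ha, hb.
  assert (hsum : forall x y z, Rabs x <= C -> Rabs y <= C -> Rabs z <= C ->
    Rabs (s * (x + y) * z) <= 2 * (Rabs s * C * C)).
  { intros x y z hx hy hz; rewrite !Rabs_mult.
    assert (h := Rabs_triang x y); assert (h0 := Rabs_pos s).
    assert (h1 := Rabs_pos (x + y)); assert (h2 := Rabs_pos z).
    assert (Rabs (x + y) * Rabs z <= 2 * C * C) by (apply Rmult_le_compat; lra).
    rewrite !Rmult_assoc; replace (2 * (Rabs s * (C * C))) with (Rabs s * (2 * C * C)) by ring.
    apply Rmult_le_compat_l; lra. }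
  eapply Rle_trans; [apply Rabs_triang|]; rewrite Rabs_Ropp.
  assert (h1 := hsum (a (k + 1)%Z) (a (k - 1)%Z) (b (k + 1)%Z) (hCa _) (hCa _) (hCb _)).
  assert (h2 := hsum (b (k + 1)%Z) (b (k - 1)%Z) (a (k + 1)%Z) (hCb _) (hCb _) (hCa _)).
  lra. }
enough (e : D 0%Z = 0) by (unfold D in e; simpl in e; lra).
destruct (Req_dec (D 0%Z) 0) as [e|hD]; [easy|exfalso].
set (M := 4 * (Rabs s * C * C)) in *.
assert (hM : 0 <= M) by (unfold M; assert (h := Rabs_pos s); assert (0 <= C * C) by nra;
  assert (0 <= Rabs s * (C * C)) by (apply Rmult_le_pos; lra); lra).
assert (hp := Rabs_pos_lt _ hD).
destruct (hw ((M + 1) / Rabs (D 0%Z))) as [k hk].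
assert (h := hbound k); rewrite hconst, Rabs_mult in h.
assert (h' : M + 1 <= w k * Rabs (D 0%Z)).
{ apply (Rmult_le_compat_r (Rabs (D 0%Z))) in hk; [|lra].
  unfold Rdiv in hk; rewrite Rmult_assoc, Rinv_l in hk by lra; lra. }
generalize (Rle_abs (w k)); nra.
Qed.

Lemma RInt_scal_real (f : R -> R) (k a b : R) :
  ex_RInt f a b -> RInt (fun t => k * f t) a b = k * RInt f a b.
Proof. exact (RInt_scal f a b k). Qed.

(* The weights [(1 + cos 2t)^N] concentrate at [0]. *)
Lemma concentration (h : R -> R) (d : R) :
  (forall t : R, continuous h t) -> 0 < d <= PI / 2 ->
  (forall t, 0 < t < d -> 0 < h t) ->
  ~ (forall N, RInt (fun t => h t * (1 + cos (2 * t)) ^ N) 0 (PI / 2) = 0).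
Proof.
intros hc hd hpos hzero.
set (m := fun t => 1 + cos (2 * t)).
set (d1 := d / 2); set (m1 := m d1); set (m2 := m d).
assert (hm : forall x y, 0 <= x <= y -> y <= PI / 2 -> 0 <= m y <= m x).
{ intros x y hxy hy; unfold m; generalize (COS_bound (2 * y)).
  assert (cos (2 * y) <= cos (2 * x)) by (apply cos_decr_1; lra); lra. }
assert (hm12 : m2 < m1).
{ unfold m2, m1, m; assert (cos (2 * d) < cos (2 * d1)); [|lra].
  apply cos_decreasing_1; unfold d1; lra. }
assert (hm2 : 0 <= m2) by (apply (hm 0 d); lra).
assert (hcm : forall N (t : R), continuous (fun t => m t ^ N) t).
{ intros N t; apply (ex_derive_continuous (fun t => m t ^ N)); unfold m; auto_derive; easy. }
assert (hch : forall N (t : R), continuous (fun t => h t * m t ^ N) t)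
  by (intros N t; apply (continuous_mult h (fun t => m t ^ N)); auto).
assert (hex : forall N a b, ex_RInt (fun t => h t * m t ^ N) a b)
  by (intros N a b; apply (ex_RInt_continuous (fun t => h t * m t ^ N)); auto).
assert (hexh : forall a b, ex_RInt h a b)
  by (intros a b; apply (ex_RInt_continuous h); auto).
assert (hca : forall t : R, continuous (fun t => Rabs (h t)) t)
  by (intros t; apply (continuous_comp h Rabs); [auto|apply continuous_Rabs]).
set (I0 := RInt h 0 d1); set (J := RInt (fun t => Rabs (h t)) d (PI / 2)).
assert (hI : 0 < I0).
{ apply RInt_gt_0; unfold d1 in *; [lra|intros t ht; apply hpos; lra|intros; apply hc]. }
assert (hJ : 0 <= J).
{ apply RInt_ge_0; [lra|apply (ex_RInt_continuous (fun t => Rabs (h t))); auto|].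
  intros; apply Rabs_pos. }
(* The integral is split at [d1 = d / 2] and [d]: the first piece is at least [m1 ^ N * I0], the
   middle one is nonnegative, and the last is at most [m2 ^ N * J] in absolute value. The gap
   between [d1] and [d] gives [m2 < m1], so letting [N] grow contradicts [0 < I0]. *)
assert (hN : forall N, m1 ^ N * I0 <= m2 ^ N * J).
{ intros N; assert (e := hzero N); fold m in e.
  change (RInt (fun t => h t * m t ^ N) 0 (PI / 2) = 0) in e.
  rewrite <- (RInt_Chasles _ 0 d1), <- (RInt_Chasles _ d1 d) in e by auto.
  unfold plus in e; simpl in e.
  assert (h1 : m1 ^ N * I0 <= RInt (fun t => h t * m t ^ N) 0 d1).
  { unfold I0; rewrite <- RInt_scal_real by auto.
    apply RInt_le; [unfold d1; lra|apply (ex_RInt_scal h); auto|auto|].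
    intros t ht; rewrite Rmult_comm.
    apply Rmult_le_compat_l; [left; apply hpos; unfold d1 in ht; lra|].
    apply pow_incr; apply hm; unfold d1 in *; lra. }
  assert (h2 : 0 <= RInt (fun t => h t * m t ^ N) d1 d).
  { apply RInt_ge_0; [unfold d1; lra|auto|].
    intros t ht; apply Rmult_le_pos; [left; apply hpos; unfold d1 in ht; lra|].
    apply pow_le, (hm t t); unfold d1 in *; lra. }
  assert (h3 : Rabs (RInt (fun t => h t * m t ^ N) d (PI / 2)) <= m2 ^ N * J).
  { eapply Rle_trans; [apply abs_RInt_le; [lra|auto]|].
    unfold J; rewrite <- RInt_scal_real
      by (apply (ex_RInt_continuous (fun t => Rabs (h t))); auto).
    apply RInt_le; [lra| | |].
    - apply (ex_RInt_continuous (fun t => Rabs (h t * m t ^ N))).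
      intros t _; apply (continuous_comp (fun t => h t * m t ^ N) Rabs);
        [apply hch|apply continuous_Rabs].
    - apply (ex_RInt_scal (fun t => Rabs (h t))).
      apply (ex_RInt_continuous (fun t => Rabs (h t))); auto.
    - intros t ht.
      rewrite Rabs_mult, (Rmult_comm (m2 ^ N)).
      apply Rmult_le_compat_l; [apply Rabs_pos|].
      rewrite Rabs_right; [|apply Rle_ge, pow_le, (hm t t); lra].
      apply pow_incr, hm; lra. }
  apply Rabs_le_between in h3; lra. }
set (r := m2 / m1).
assert (hr : Rabs r < 1).
{ unfold r; rewrite Rabs_right.
  - apply (Rmult_lt_reg_r m1); [lra|]; unfold Rdiv; rewrite Rmult_assoc, Rinv_l; lra.
  - apply Rle_ge, Rdiv_le_0_compat; lra. }
assert (hlim := is_lim_seq_scal_l _ J _ (is_lim_seq_geom r hr)).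
simpl in hlim; rewrite Rmult_0_r in hlim.
assert (hle : Rbar_le I0 0).
{ apply (is_lim_seq_le (fun _ => I0) (fun N => J * r ^ N) I0 0); auto.
  - intros N; unfold r, Rdiv; rewrite Rpow_mult_distr, pow_inv.
    apply (Rmult_le_reg_l (m1 ^ N)); [apply pow_lt; lra|].
    eapply Rle_trans; [apply hN|right; field; apply pow_nonzero; lra].
  - apply is_lim_seq_const. }
simpl in hle; lra.
Qed.

(** * Fourier coefficients on half a period *)

Definition hill_potential (c s t : R) : R := c + s * cos t ^ 2.

Lemma continuous_hill_potential (c s t : R) : continuous (hill_potential c s) t.
Proof.
apply (ex_derive_continuous (hill_potential c s)); unfold hill_potential; auto_derive; easy.
Qed.

Lemma cos_shift_sum (w chi t : R) :
  cos (2 * t) * cos (w * t - chi)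
  = (cos ((w + 2) * t - chi) + cos ((w - 2) * t - chi)) / 2.
Proof.
replace ((w + 2) * t - chi) with ((w * t - chi) + 2 * t) by ring.
replace ((w - 2) * t - chi) with ((w * t - chi) - 2 * t) by ring.
generalize (w * t - chi); intros x; rewrite cos_plus, cos_minus; field.
Qed.

Section Fourier.

Variables (f : R -> R) (chi : R).
Hypothesis hf : forall t : R, continuous f t.

(** The phase [chi] is [0] for cosine and [PI / 2] for sine coefficients. The parity of the
    solutions makes half a period enough, and a real frequency [w] covers the periodic case (even
    integers) and the antiperiodic one (odd integers) together. *)
Definition fourier (w : R) : R := RInt (fun t => f t * cos (w * t - chi)) 0 (PI / 2).

Lemma continuous_cos_affine w (t : R) : continuous (fun t => cos (w * t - chi)) t.
Proof. apply (ex_derive_continuous (fun t => cos (w * t - chi))); auto_derive; easy. Qed.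

Lemma ex_fourier w : ex_RInt (fun t => f t * cos (w * t - chi)) 0 (PI / 2).
Proof.
apply (ex_RInt_continuous (fun t => f t * cos (w * t - chi))); intros t _.
apply (continuous_mult f (fun t => cos (w * t - chi))); [apply hf|apply continuous_cos_affine].
Qed.

Lemma fourier_correct w :
  is_RInt (fun t => f t * cos (w * t - chi)) 0 (PI / 2) (fourier w).
Proof. apply (RInt_correct (fun t => f t * cos (w * t - chi))), ex_fourier. Qed.

Lemma fourier_bound w : Rabs (fourier w) <= RInt (fun t => Rabs (f t)) 0 (PI / 2).
Proof.
assert (hpi := PI_RGT_0).
eapply Rle_trans; [apply abs_RInt_le; [lra|apply ex_fourier]|].
apply RInt_le; [lra| | |].
- apply (ex_RInt_continuous (fun t => Rabs (f t * cos (w * t - chi)))); intros t _.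
  apply (continuous_comp (fun t => f t * cos (w * t - chi)) Rabs); [|apply continuous_Rabs].
  apply (continuous_mult f (fun t => cos (w * t - chi))); [apply hf|apply continuous_cos_affine].
- apply (ex_RInt_continuous (fun t => Rabs (f t))); intros t _.
  apply (continuous_comp f Rabs); [auto|apply continuous_Rabs].
- intros t _; rewrite Rabs_mult.
  assert (Rabs (cos (w * t - chi)) <= 1) by apply Rabs_le, COS_bound.
  generalize (Rabs_pos (f t)); nra.
Qed.

Lemma fourier_recurrence (c s w : R) (df : R -> R) :
  hill_solution (hill_potential c s) f df ->
  (forall t, t = 0 \/ t = PI / 2 ->
     df t * cos (w * t - chi) + w * f t * sin (w * t - chi) = 0) ->
  (w ^ 2 - c - s / 2) * fourier w = s / 4 * (fourier (w + 2) + fourier (w - 2)).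
Proof.
intros hs hbc.
(* The boundary term of two integrations by parts: its derivative is [(w^2 - p) f cos (w t - chi)],
   and the hypothesis makes it vanish at both ends. *)
set (H := fun t => df t * cos (w * t - chi) + w * f t * sin (w * t - chi)).
set (g := fun t => (w ^ 2 - hill_potential c s t) * (f t * cos (w * t - chi))).
assert (hH : forall t, is_derive H t (g t)).
{ intros t; destruct (hs t) as [h1 h2]; unfold H, g; eapply is_derive_eq.
  - apply (is_derive_plus (fun t => df t * cos (w * t - chi))
      (fun t => w * f t * sin (w * t - chi))).
    + apply (is_derive_mult df (fun t => cos (w * t - chi)));
        [apply h2|auto_derive; [easy|reflexivity]|intros; apply Rmult_comm].
    + apply (is_derive_mult (fun t => w * f t) (fun t => sin (w * t - chi))).
      * apply (is_derive_scal f t w), h1.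
      * auto_derive; [easy|reflexivity].
      * intros; apply Rmult_comm.
  - unfold plus, mult; cbn -[pow]; unfold Rminus; ring. }
assert (hg : forall t : R, continuous g t).
{ intros t; apply (continuous_mult (fun t => w ^ 2 - hill_potential c s t)
    (fun t => f t * cos (w * t - chi))).
  - apply (continuous_minus (fun _ => w ^ 2) (hill_potential c s));
      [apply continuous_const|apply continuous_hill_potential].
  - apply (continuous_mult f (fun t => cos (w * t - chi)));
      [apply hf|apply continuous_cos_affine]. }
assert (e : is_RInt g 0 (PI / 2) 0).
{ replace 0 with (minus (H (PI / 2)) (H 0)) at 2.
  - apply (is_RInt_derive H g); auto.
  - unfold H; rewrite !hbc by auto; apply Rminus_diag. }
assert (e' : is_RInt g 0 (PI / 2)
  ((w ^ 2 - c - s / 2) * fourier w - s / 4 * (fourier (w + 2) + fourier (w - 2)))).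
{ apply is_RInt_ext with (fun t => minus
     (scal (w ^ 2 - c - s / 2) (f t * cos (w * t - chi)))
     (scal (s / 4) (plus (f t * cos ((w + 2) * t - chi)) (f t * cos ((w - 2) * t - chi))))).
  - intros t _; unfold g, hill_potential, minus, plus, opp, scal; cbn -[pow].
    unfold mult; cbn -[pow].
    assert (h := cos_shift_sum w chi t); rewrite cos_2a_cos in h.
    transitivity (f t * ((w ^ 2 - c - s / 2) * cos (w * t - chi)
      - s / 2 * ((cos ((w + 2) * t - chi) + cos ((w - 2) * t - chi)) / 2))); [field|].
    rewrite <- h; field.
  - apply (is_RInt_minus (V := R_NormedModule)).
    + apply (is_RInt_scal (fun t => f t * cos (w * t - chi))), fourier_correct.
    + apply (is_RInt_scal (fun t => plus (f t * cos ((w + 2) * t - chi))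
        (f t * cos ((w - 2) * t - chi)))).
      apply (is_RInt_plus (fun t => f t * cos ((w + 2) * t - chi))
        (fun t => f t * cos ((w - 2) * t - chi))); apply fourier_correct. }
assert (e1 := is_RInt_unique _ _ _ _ e); assert (e2 := is_RInt_unique _ _ _ _ e').
lra.
Qed.

(** Multiplication by [1 + cos 2t] maps the frequency [w] to a combination of [w], [w + 2] and
    [w - 2], so it stays within the family [w0 + 2 k], and induction on [N] applies to all [k] at
    once. *)
Lemma fourier_zero_concentrated (w0 : R) :
  (forall k : Z, fourier (w0 + 2 * IZR k) = 0) -> forall N (k : Z),
  RInt (fun t => f t * cos ((w0 + 2 * IZR k) * t - chi) * (1 + cos (2 * t)) ^ N) 0 (PI / 2) = 0.
Proof.
intros hz N.
set (w := fun k => w0 + 2 * IZR k).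
set (I := fun N k t => f t * cos (w k * t - chi) * (1 + cos (2 * t)) ^ N).
assert (hI : forall N k, ex_RInt (I N k) 0 (PI / 2)).
{ intros n k; apply (ex_RInt_continuous (I n k)); intros t _.
  apply (continuous_mult (fun t => f t * cos (w k * t - chi)) (fun t => (1 + cos (2 * t)) ^ n)).
  - apply (continuous_mult f (fun t => cos (w k * t - chi)));
      [apply hf|apply continuous_cos_affine].
  - apply (ex_derive_continuous (fun t => (1 + cos (2 * t)) ^ n)); auto_derive; easy. }
induction N as [|N IH]; intros k.
- transitivity (fourier (w0 + 2 * IZR k)); [|apply hz].
  apply RInt_ext; intros t _; apply Rmult_1_r.
- change (RInt (I (S N) k) 0 (PI / 2) = 0); apply is_RInt_unique.
  apply is_RInt_ext with (fun t => plus (I N k t)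
    (scal (1 / 2) (plus (I N (k + 1)%Z t) (I N (k - 1)%Z t)))).
  + intros t _; unfold I, w, plus, scal; cbn -[IZR]; unfold mult; cbn -[IZR].
    rewrite plus_IZR, minus_IZR.
    replace (w0 + 2 * (IZR k + 1)) with (w0 + 2 * IZR k + 2) by ring.
    replace (w0 + 2 * (IZR k - 1)) with (w0 + 2 * IZR k - 2) by ring.
    assert (h := cos_shift_sum (w0 + 2 * IZR k) chi t).
    set (A := cos ((w0 + 2 * IZR k + 2) * t - chi)) in *.
    set (B := cos ((w0 + 2 * IZR k - 2) * t - chi)) in *.
    replace A with (2 * ((A + B) / 2) - B) by field.
    rewrite <- h; field.
  + replace 0 with (plus (RInt (I N k) 0 (PI / 2)) (scal (1 / 2)
      (plus (RInt (I N (k + 1)%Z) 0 (PI / 2)) (RInt (I N (k - 1)%Z) 0 (PI / 2))))) at 2.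
    * apply (is_RInt_plus (I N k)); [apply (RInt_correct (I N k)), hI|].
      apply (is_RInt_scal (fun t => plus (I N (k + 1)%Z t) (I N (k - 1)%Z t))).
      apply (is_RInt_plus (I N (k + 1)%Z) (I N (k - 1)%Z));
        [apply (RInt_correct (I N (k + 1)%Z))|apply (RInt_correct (I N (k - 1)%Z))];
        apply hI.
    * change (RInt (I N k) 0 (PI / 2) + 1 / 2 *
        (RInt (I N (k + 1)%Z) 0 (PI / 2) + RInt (I N (k - 1)%Z) 0 (PI / 2)) = 0).
      unfold I, w; rewrite !IH; ring.
Qed.

(** Takes the place of completeness: a function with the sign of one of the modes near [0] cannot
    have all its coefficients zero. *)
Lemma fourier_nonzero (w0 d : R) (k : Z) :
  0 < d <= PI / 2 ->
  (forall t, 0 < t < d -> 0 < f t * cos ((w0 + 2 * IZR k) * t - chi)) ->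
  ~ (forall k : Z, fourier (w0 + 2 * IZR k) = 0).
Proof.
intros hd hpos hz.
apply (concentration (fun t => f t * cos ((w0 + 2 * IZR k) * t - chi)) d); auto.
- intros t; apply (continuous_mult f (fun t => cos ((w0 + 2 * IZR k) * t - chi)));
    [apply hf|apply continuous_cos_affine].
- intros N; now apply fourier_zero_concentrated.
Qed.

End Fourier.

Lemma fourier_even (f : R -> R) (w : R) : fourier f 0 (- w) = fourier f 0 w.
Proof.
apply RInt_ext; intros t _; f_equal.
replace (- w * t - 0) with (- (w * t - 0)) by ring; apply cos_neg.
Qed.

Lemma fourier_odd (f : R -> R) (w : R) :
  (forall t : R, continuous f t) -> fourier f (PI / 2) (- w) = - fourier f (PI / 2) w.
Proof.
intros hf.
assert (e := RInt_scal_real (fun t => f t * cos (w * t - PI / 2)) (- 1) 0 (PI / 2)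
  (ex_fourier _ _ hf _)).
transitivity (-1 * fourier f (PI / 2) w); [|ring].
eapply eq_trans; [|exact e]; apply RInt_ext; intros t _.
rewrite <- cos_neg; replace (- (- w * t - PI / 2)) with (w * t - PI / 2 + PI) by field.
rewrite neg_cos.
change (f t * - cos (w * t - PI / 2) = -1 * (f t * cos (w * t - PI / 2))); ring.
Qed.

Lemma positive_near_0 (f : R -> R) :
  continuous f 0 -> 0 < f 0 ->
  exists d, 0 < d <= PI / 2 /\ forall t, 0 <= t < d -> 0 < f t.
Proof.
intros hf h0.
destruct (hf (fun y => 0 < y)) as [e he].
{ exists (mkposreal _ h0); intros y hy; apply Rabs_lt_between' in hy; simpl in hy; lra. }
assert (hpi := PI_RGT_0); assert (hep := cond_pos e).
exists (Rmin e (PI / 2)); split; [split|].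
- apply Rmin_pos; lra.
- apply Rmin_r.
- intros t ht; apply he, Rabs_lt_between'.
  generalize (Rmin_l e (PI / 2)); lra.
Qed.

Lemma hill_continuous p x dx : hill_solution p x dx ->
  (forall t : R, continuous x t) /\ (forall t : R, continuous dx t).
Proof. intros h; split; intros t; destruct (h t); eapply is_derive_continuous; eauto. Qed.

(** * Ince's theorem for the even and odd solutions *)

Section NoCoexistence.

Variables (c s : R) (u du v dv : R -> R).
Hypothesis s_neq0 : s <> 0.
Hypothesis hu : hill_solution (hill_potential c s) u du.
Hypothesis hv : hill_solution (hill_potential c s) v dv.
Hypothesis u0 : u 0 = 1.
Hypothesis du0 : du 0 = 0.
Hypothesis v0 : v 0 = 0.
Hypothesis dv0 : dv 0 = 1.

Lemma even_positive_near_0 w :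
  exists d, 0 < d <= PI / 2 /\ forall t, 0 < t < d -> 0 < u t * cos (w * t - 0).
Proof.
assert (hc : continuous (fun t => u t * cos (w * t - 0)) 0).
{ apply (continuous_mult u (fun t => cos (w * t - 0)));
    [apply (proj1 (hill_continuous _ _ _ hu))|apply continuous_cos_affine]. }
destruct (positive_near_0 _ hc) as [d [hd h]].
- rewrite u0, Rmult_0_r, Rminus_0_r, cos_0; lra.
- exists d; split; [easy|]; intros t ht; apply h; lra.
Qed.

(** Here both factors vanish at [0]: [v] is positive because [v' (0) = 1], and the cosine is
    [sin (w t)], positive on [(0, pi/2)] since [w <= 2]. *)
Lemma odd_positive_near_0 w : 0 < w <= 2 ->
  exists d, 0 < d <= PI / 2 /\ forall t, 0 < t < d -> 0 < v t * cos (w * t - PI / 2).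
Proof.
intros hw.
destruct (positive_near_0 dv) as [d [hd h]].
- apply (proj2 (hill_continuous _ _ _ hv)).
- lra.
- exists d; split; [easy|]; intros t ht; apply Rmult_lt_0_compat.
  + destruct (MVT_gen v 0 t dv) as [r [hr e]].
    * intros r _; apply hv.
    * intros r _; apply continuity_pt_filterlim, (proj1 (hill_continuous _ _ _ hv)).
    * rewrite Rmin_left, Rmax_right in hr by lra.
      assert (0 < dv r) by (apply h; lra); nra.
  + rewrite <- cos_neg, Ropp_minus_distr, cos_shift; apply sin_gt_0; nra.
Qed.

Section BoundaryConditions.

Variable w0 : R.
Hypothesis u_bc : forall k : Z, du (PI / 2) * cos ((w0 + 2 * IZR k) * (PI / 2) - 0)
  + (w0 + 2 * IZR k) * u (PI / 2) * sin ((w0 + 2 * IZR k) * (PI / 2) - 0) = 0.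
Hypothesis v_bc : forall k : Z, dv (PI / 2) * cos ((w0 + 2 * IZR k) * (PI / 2) - PI / 2)
  + (w0 + 2 * IZR k) * v (PI / 2) * sin ((w0 + 2 * IZR k) * (PI / 2) - PI / 2) = 0.

Let w k := (w0 + 2 * IZR k) ^ 2 - c - s / 2.
Let a k := fourier u 0 (w0 + 2 * IZR k).
Let b k := fourier v (PI / 2) (w0 + 2 * IZR k).

Lemma even_recurrence k : w k * a k = s / 4 * (a (k + 1)%Z + a (k - 1)%Z).
Proof.
unfold w, a; rewrite plus_IZR, minus_IZR.
rewrite (fourier_recurrence u 0 (proj1 (hill_continuous _ _ _ hu)) c s _ du hu).
- do 2 f_equal; f_equal; ring.
- intros t [->| ->]; [|apply u_bc].
  rewrite du0, Rmult_0_r, Rminus_0_r, sin_0; ring.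
Qed.

Lemma odd_recurrence k : w k * b k = s / 4 * (b (k + 1)%Z + b (k - 1)%Z).
Proof.
unfold w, b; rewrite plus_IZR, minus_IZR.
rewrite (fourier_recurrence v _ (proj1 (hill_continuous _ _ _ hv)) c s _ dv hv).
- do 2 f_equal; f_equal; ring.
- intros t [->| ->]; [|apply v_bc].
  rewrite v0, Rmult_0_r, Rminus_0_l, cos_neg, cos_PI2; ring.
Qed.

Lemma coexistence_casorati : a 0%Z * b 1%Z = a 1%Z * b 0%Z.
Proof.
apply (three_term_dependent (s / 4)
  (RInt (fun t => Rabs (u t)) 0 (PI / 2) + RInt (fun t => Rabs (v t)) 0 (PI / 2)) w).
- lra.
- apply even_recurrence.
- apply odd_recurrence.
- intros k; eapply Rle_trans;
    [exact (fourier_bound u 0 (proj1 (hill_continuous _ _ _ hu)) (w0 + 2 * IZR k))|].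
  (* Any coefficient of [v] would do: its bound only serves to show that the other integral in the
     constant is nonnegative. *)
  assert (h := fourier_bound v 0 (proj1 (hill_continuous _ _ _ hv)) 0).
  generalize (Rabs_pos (fourier v 0 0)); lra.
- intros k; eapply Rle_trans;
    [exact (fourier_bound v _ (proj1 (hill_continuous _ _ _ hv)) (w0 + 2 * IZR k))|].
  assert (h := fourier_bound u 0 (proj1 (hill_continuous _ _ _ hu)) 0).
  generalize (Rabs_pos (fourier u 0 0)); lra.
- intros A.
  destruct (archimed (Rabs w0 + Rabs (A + c + s / 2))) as [h _].
  set (k := up (Rabs w0 + Rabs (A + c + s / 2))) in *.
  (* The frequency [x] is then at least [1] and at least [Rabs (A + c + s / 2)], so [x^2 >= x]
     suffices. *)
  exists (k + 1)%Z; unfold w; rewrite plus_IZR.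
  assert (h1 := Rle_abs (- w0)); assert (h2 := Rle_abs (A + c + s / 2)).
  rewrite Rabs_Ropp in h1.
  assert (h3 := Rabs_pos w0); assert (h4 := Rabs_pos (A + c + s / 2)).
  set (x := w0 + 2 * (IZR k + 1)).
  assert (Rabs (A + c + s / 2) <= x) by (unfold x; lra).
  assert (1 <= x) by (unfold x; lra).
  nra.
Qed.

Lemma even_fourier_not_zero k : a k = 0 -> a (k + 1)%Z = 0 -> False.
Proof.
intros h0 h1.
destruct (even_positive_near_0 (w0 + 2 * IZR 0)) as [d [hd hpos]].
apply (fourier_nonzero u 0 (proj1 (hill_continuous _ _ _ hu)) w0 d 0%Z hd hpos).
apply (three_term_zero (s / 4) w a k); [lra|apply even_recurrence|easy|easy].
Qed.

Lemma odd_fourier_not_zero k m : 0 < w0 + 2 * IZR m <= 2 ->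
  b k = 0 -> b (k + 1)%Z = 0 -> False.
Proof.
intros hm h0 h1.
destruct (odd_positive_near_0 _ hm) as [d [hd hpos]].
apply (fourier_nonzero v _ (proj1 (hill_continuous _ _ _ hv)) w0 d m hd hpos).
apply (three_term_zero (s / 4) w b k); [lra|apply odd_recurrence|easy|easy].
Qed.

End BoundaryConditions.

(** Frequencies [2 k]. The sine coefficient [b 0] is zero, so the Casoratian leaves [a 0 * b 1 = 0].
    If [a 0 = 0], the recurrence at [0] with [a (-1) = a 1] gives [a 1 = 0]; if [b 1 = 0], then
    [b 0] and [b 1] both vanish. Either way a nontrivial solution has two consecutive zero
    coefficients. *)
Lemma no_coexistence_periodic : du (PI / 2) = 0 -> v (PI / 2) = 0 -> False.
Proof.
intros hdu hv2.
assert (hub : forall k : Z, du (PI / 2) * cos ((0 + 2 * IZR k) * (PI / 2) - 0)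
  + (0 + 2 * IZR k) * u (PI / 2) * sin ((0 + 2 * IZR k) * (PI / 2) - 0) = 0).
{ intros k; rewrite hdu, (sin_eq_0_1 (_ - 0)); [ring|exists k; field]. }
assert (hvb : forall k : Z, dv (PI / 2) * cos ((0 + 2 * IZR k) * (PI / 2) - PI / 2)
  + (0 + 2 * IZR k) * v (PI / 2) * sin ((0 + 2 * IZR k) * (PI / 2) - PI / 2) = 0).
{ intros k; rewrite hv2, (cos_eq_0_1 (_ - PI / 2)); [ring|].
  exists (k - 1)%Z; rewrite minus_IZR; field. }
assert (e := coexistence_casorati 0 hub hvb); cbv beta zeta in e.
assert (b0 : fourier v (PI / 2) (0 + 2 * IZR 0) = 0).
{ assert (h := fourier_odd v 0 (proj1 (hill_continuous _ _ _ hv))).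
  rewrite Ropp_0 in h; replace (0 + 2 * IZR 0) with 0 by ring; lra. }
rewrite b0, (Rmult_0_r (fourier _ _ _)) in e; apply Rmult_integral in e; destruct e as [e|e].
- apply (even_fourier_not_zero 0 hub 0 e).
  assert (h := even_recurrence 0 hub 0); cbv beta zeta in *.
  rewrite e in h; simpl Z.add in *; simpl Z.sub in h.
  replace (0 + 2 * IZR (-1)) with (- (0 + 2 * IZR 1)) in h by ring.
  rewrite fourier_even in h.
  apply (Rmult_eq_reg_l (s / 2)); lra.
- apply (odd_fourier_not_zero 0 hvb 0 1); [lra|exact b0|exact e].
Qed.

(** Frequencies [2 k - 1], so the indices [0] and [1] carry [-1] and [1]. Parity gives [a 0 = a 1]
    and [b 0 = - b 1], and the Casoratian identity becomes [a 1 * b 1 = 0]. *)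
Lemma no_coexistence_antiperiodic : u (PI / 2) = 0 -> dv (PI / 2) = 0 -> False.
Proof.
intros hu2 hdv.
assert (hub : forall k : Z, du (PI / 2) * cos ((-1 + 2 * IZR k) * (PI / 2) - 0)
  + (-1 + 2 * IZR k) * u (PI / 2) * sin ((-1 + 2 * IZR k) * (PI / 2) - 0) = 0).
{ intros k; rewrite hu2, (cos_eq_0_1 (_ - 0)); [ring|].
  exists (k - 1)%Z; rewrite minus_IZR; field. }
assert (hvb : forall k : Z, dv (PI / 2) * cos ((-1 + 2 * IZR k) * (PI / 2) - PI / 2)
  + (-1 + 2 * IZR k) * v (PI / 2) * sin ((-1 + 2 * IZR k) * (PI / 2) - PI / 2) = 0).
{ intros k; rewrite hdv, (sin_eq_0_1 (_ - PI / 2)); [ring|].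
  exists (k - 1)%Z; rewrite minus_IZR; field. }
assert (e := coexistence_casorati (-1) hub hvb); cbv beta zeta in e.
assert (w1 : -1 + 2 * IZR 0 = - (-1 + 2 * IZR 1)) by ring.
rewrite w1, fourier_even, (fourier_odd _ _ (proj1 (hill_continuous _ _ _ hv))) in e.
assert (e' : fourier u 0 (-1 + 2 * IZR 1) * fourier v (PI / 2) (-1 + 2 * IZR 1) = 0) by lra.
apply Rmult_integral in e'; destruct e' as [e'|e'].
- apply (even_fourier_not_zero (-1) hub 0); [|exact e'].
  now rewrite w1, fourier_even.
- apply (odd_fourier_not_zero (-1) hvb 0 1); [lra| |exact e'].
  rewrite w1, (fourier_odd _ _ (proj1 (hill_continuous _ _ _ hv))), e'; ring.
Qed.

End NoCoexistence.

(** * Monodromy *)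

Lemma wronskian_const (p x dx y dy : R -> R) :
  hill_solution p x dx -> hill_solution p y dy ->
  forall t, x t * dy t - dx t * y t = x 0 * dy 0 - dx 0 * y 0.
Proof.
intros hx hy t.
apply (derive_zero_const (fun t => x t * dy t - dx t * y t)); intros r.
destruct (hx r) as [h1 h2], (hy r) as [h3 h4]; eapply is_derive_eq.
- apply (is_derive_minus (fun t => x t * dy t) (fun t => dx t * y t)).
  + apply (is_derive_mult x dy); [apply h1|apply h4|intros; apply Rmult_comm].
  + apply (is_derive_mult dx y); [apply h2|apply h3|intros; apply Rmult_comm].
- unfold minus, plus, opp, mult; simpl; ring.
Qed.

Lemma hill_comp_affine (p x dx : R -> R) (k h : R) :
  k ^ 2 = 1 -> (forall t, p (k * t + h) = p t) -> hill_solution p x dx ->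
  hill_solution p (fun t => x (k * t + h)) (fun t => k * dx (k * t + h)).
Proof.
intros hk hp hx t; destruct (hx (k * t + h)) as [h1 h2].
assert (ha : is_derive (fun t => k * t + h) t k) by (auto_derive; [easy|ring]).
split.
- eapply is_derive_eq.
  + apply (is_derive_comp x (fun t => k * t + h)); [apply h1|apply ha].
  + unfold scal; simpl; unfold mult; simpl; ring.
- eapply is_derive_eq.
  + apply (is_derive_scal (fun t => dx (k * t + h)) t k).
    apply (is_derive_comp dx (fun t => k * t + h)); [apply h2|apply ha].
  + unfold scal; simpl; unfold mult; cbn -[pow]; rewrite hp.
    transitivity (- (k ^ 2 * (p t * x (k * t + h)))); [ring|rewrite hk; ring].
Qed.

Lemma hill_translate (p x dx : R -> R) (h : R) :
  (forall t, p (t + h) = p t) -> hill_solution p x dx ->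
  hill_solution p (fun t => x (t + h)) (fun t => dx (t + h)).
Proof.
intros hp hx t; destruct (hx (t + h)) as [h1 h2].
assert (ha : is_derive (fun t => t + h) t 1) by (auto_derive; [easy|ring]).
split.
- eapply is_derive_eq; [apply (is_derive_comp x (fun t => t + h)); [apply h1|apply ha]|].
  apply (scal_one (dx (t + h))).
- eapply is_derive_eq; [apply (is_derive_comp dx (fun t => t + h)); [apply h2|apply ha]|].
  rewrite hp; apply (scal_one (- (p t * x (t + h)))).
Qed.

Lemma hill_lincomb (p x dx y dy : R -> R) (A B : R) :
  hill_solution p x dx -> hill_solution p y dy ->
  hill_solution p (fun t => A * x t + B * y t) (fun t => A * dx t + B * dy t).
Proof.
intros hx hy t; destruct (hx t) as [h1 h2], (hy t) as [h3 h4]; split.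
- apply (is_derive_plus (fun t => A * x t) (fun t => B * y t));
    [apply (is_derive_scal x t A)|apply (is_derive_scal y t B)]; easy.
- eapply is_derive_eq.
  + apply (is_derive_plus (fun t => A * dx t) (fun t => B * dy t)).
    * apply (is_derive_scal dx t A), h2.
    * apply (is_derive_scal dy t B), h4.
  + unfold plus; simpl; ring.
Qed.

Section Fundamental.

Variables (p u du v dv : R -> R).
Hypothesis hu : hill_solution p u du.
Hypothesis hv : hill_solution p v dv.
Hypothesis u0 : u 0 = 1.
Hypothesis du0 : du 0 = 0.
Hypothesis v0 : v 0 = 0.
Hypothesis dv0 : dv 0 = 1.

Lemma fundamental_wronskian t : u t * dv t - du t * v t = 1.
Proof. rewrite (wronskian_const p u du v dv hu hv t), u0, du0, v0, dv0; ring. Qed.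

Section Representation.

Variables (x dx : R -> R).
Hypothesis hx : hill_solution p x dx.

Lemma initial_position t : x 0 = x t * dv t - dx t * v t.
Proof. rewrite (wronskian_const p x dx v dv hx hv t), v0, dv0; ring. Qed.

Lemma initial_velocity t : dx 0 = u t * dx t - du t * x t.
Proof. rewrite (wronskian_const p u du x dx hu hx t), u0, du0; ring. Qed.

Lemma solution_eq t : x t = x 0 * u t + dx 0 * v t.
Proof.
rewrite (initial_position t), (initial_velocity t).
transitivity (x t * (u t * dv t - du t * v t)); [|ring].
rewrite fundamental_wronskian; ring.
Qed.

Lemma solution_derive_eq t : dx t = x 0 * du t + dx 0 * dv t.
Proof.
rewrite (initial_position t), (initial_velocity t).
transitivity (dx t * (u t * dv t - du t * v t)); [|ring].
rewrite fundamental_wronskian; ring.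
Qed.

End Representation.

Hypothesis p_even : forall t, p (- t) = p t.
Hypothesis p_per : forall t, p (t + PI) = p t.

Let a := u (PI / 2).
Let a' := du (PI / 2).
Let b := v (PI / 2).
Let b' := dv (PI / 2).

Lemma hill_reflect (x dx : R -> R) : hill_solution p x dx ->
  hill_solution p (fun t => x (-1 * t + PI)) (fun t => -1 * dx (-1 * t + PI)).
Proof.
apply hill_comp_affine; [ring|].
intros t; rewrite p_per; replace (-1 * t) with (- t) by ring; apply p_even.
Qed.

(* Reflection about [pi/2] expresses the monodromy matrix by values at [pi/2]. *)
Lemma monodromy :
  u PI = a * b' + a' * b /\ du PI = 2 * (a * a') /\
  v PI = 2 * (b * b') /\ dv PI = a * b' + a' * b.
Proof.
assert (e : -1 * (PI / 2) + PI = PI / 2) by field.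
assert (e0 : -1 * 0 + PI = PI) by ring.
assert (h1 := initial_position _ _ (hill_reflect u du hu) (PI / 2)).
assert (h2 := initial_velocity _ _ (hill_reflect u du hu) (PI / 2)).
assert (h3 := initial_position _ _ (hill_reflect v dv hv) (PI / 2)).
assert (h4 := initial_velocity _ _ (hill_reflect v dv hv) (PI / 2)).
cbv beta in h1, h2, h3, h4; rewrite e, e0 in h1, h2, h3, h4.
fold a a' b b' in h1, h2, h3, h4; repeat split; lra.
Qed.

Lemma monodromy_step (x dx : R -> R) : hill_solution p x dx ->
  x PI = (a * b' + a' * b) * x 0 + 2 * (b * b') * dx 0 /\
  dx PI = 2 * (a * a') * x 0 + (a * b' + a' * b) * dx 0.
Proof.
intros hx; destruct monodromy as [e1 [e2 [e3 e4]]].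
rewrite (solution_eq x dx hx PI), (solution_derive_eq x dx hx PI), e1, e2, e3, e4.
split; ring.
Qed.

Lemma hill_shift (x dx : R -> R) (n : nat) : hill_solution p x dx ->
  hill_solution p (fun t => x (t + INR n * PI)) (fun t => dx (t + INR n * PI)).
Proof.
apply hill_translate; induction n as [|n IH]; intros r.
- f_equal; simpl; ring.
- rewrite S_INR.
  replace (r + (INR n + 1) * PI) with ((r + INR n * PI) + PI) by ring.
  now rewrite p_per.
Qed.

Lemma monodromy_iter_step (x dx : R -> R) (n : nat) : hill_solution p x dx ->
  x (INR (S n) * PI) = (a * b' + a' * b) * x (INR n * PI) + 2 * (b * b') * dx (INR n * PI) /\
  dx (INR (S n) * PI) = 2 * (a * a') * x (INR n * PI) + (a * b' + a' * b) * dx (INR n * PI).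
Proof.
intros hx; destruct (monodromy_step _ _ (hill_shift x dx n hx)) as [h1 h2].
cbv beta in h1, h2; rewrite !Rplus_0_l in h1, h2.
rewrite S_INR; replace ((INR n + 1) * PI) with (PI + INR n * PI) by ring; easy.
Qed.

Lemma det_half_period : (a * b' + a' * b) ^ 2 - 4 * (a * a' * b * b') = 1.
Proof.
assert (h := fundamental_wronskian (PI / 2)); fold a a' b b' in h.
transitivity ((a * b' - a' * b) ^ 2); [ring|rewrite h; ring].
Qed.

Lemma bounded_continuous (f : R -> R) (x y : R) : (forall t : R, continuous f t) ->
  exists K, 0 <= K /\ forall t, x <= t <= y -> Rabs (f t) <= K.
Proof.
intros hf; destruct (bounded_continuity f x y) as [K hK]; [intros; apply hf|].
exists (Rabs K); split; [apply Rabs_pos|]; intros t ht.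
generalize (hK t ht) (Rle_abs K); unfold norm; simpl; unfold abs; simpl; lra.
Qed.

(* The monodromy matrix preserves the definite form [a a' X^2 - b b' Y^2]. *)
Lemma stable_bounded_pos (x dx : R -> R) : a * a' * (b * b') < 0 ->
  hill_solution p x dx ->
  exists K, 0 <= K /\ forall t, 0 <= t -> Rabs (x t) <= K /\ Rabs (dx t) <= K.
Proof.
intros hneg hx.
set (Q := fun n => a * a' * x (INR n * PI) ^ 2 - b * b' * dx (INR n * PI) ^ 2).
assert (hQ : forall n, Q n = Q 0%nat).
{ induction n as [|n IH]; [easy|]; rewrite <- IH; unfold Q.
  destruct (monodromy_iter_step x dx n hx) as [-> ->].
  assert (e := det_half_period).
  transitivity (((a * b' + a' * b) ^ 2 - 4 * (a * a' * b * b')) *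
    (a * a' * x (INR n * PI) ^ 2 - b * b' * dx (INR n * PI) ^ 2)); [ring|].
  rewrite e; ring. }
assert (hX : exists B, 0 <= B /\ forall n,
  Rabs (x (INR n * PI)) <= B /\ Rabs (dx (INR n * PI)) <= B).
(* A crude bound, [r^2 <= A] implies [|r| <= A + 1], that avoids square roots. *)
{ assert (hn : forall k r q, 0 < k -> k * r ^ 2 <= q -> Rabs r <= q / k + 1).
  { intros k r q hk hr.
    assert (h : r ^ 2 <= q / k).
    { apply (Rmult_le_reg_l k); [easy|]; unfold Rdiv.
      rewrite (Rmult_comm q), <- Rmult_assoc, Rinv_r, Rmult_1_l; lra. }
    apply Rabs_le; nra. }
  assert (hk : exists k l, 0 < k /\ 0 < l /\ exists q, 0 <= q /\ forall n,
     k * x (INR n * PI) ^ 2 <= q /\ l * dx (INR n * PI) ^ 2 <= q).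
  { assert (hsq := fun r => pow2_ge_0 r).
    destruct (Rdichotomy (a * a') 0) as [ha|h];
      [intros e; rewrite e in hneg; lra| |].
    - assert (hb : 0 < b * b') by nra.
      exists (- (a * a')), (b * b'); repeat split; try lra.
      exists (- Q 0%nat); split.
      + unfold Q; assert (h1 := hsq (x (INR 0 * PI))); assert (h2 := hsq (dx (INR 0 * PI))); nra.
      + intros n; rewrite <- (hQ n); unfold Q.
        assert (h1 := hsq (x (INR n * PI))); assert (h2 := hsq (dx (INR n * PI))); nra.
    - assert (hb : b * b' < 0) by nra.
      exists (a * a'), (- (b * b')); repeat split; try lra.
      exists (Q 0%nat); split.
      + unfold Q; assert (h1 := hsq (x (INR 0 * PI))); assert (h2 := hsq (dx (INR 0 * PI))); nra.
      + intros n; rewrite <- (hQ n); unfold Q.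
        assert (h1 := hsq (x (INR n * PI))); assert (h2 := hsq (dx (INR n * PI))); nra. }
  destruct hk as [k [l [hk [hl [q [hq h]]]]]].
  assert (h1 : 0 <= q / k) by now apply Rdiv_le_0_compat.
  assert (h2 : 0 <= q / l) by now apply Rdiv_le_0_compat.
  exists (q / k + 1 + (q / l + 1)); split; [lra|]; intros n; destruct (h n) as [h3 h4].
  apply hn in h3; [|easy]; apply hn in h4; [|easy]; lra. }
destruct hX as [B [hB hX]].
destruct (hill_continuous _ _ _ hu) as [cu cdu], (hill_continuous _ _ _ hv) as [cv cdv].
destruct (bounded_continuous u 0 PI cu) as [K1 [hK1 bK1]].
destruct (bounded_continuous du 0 PI cdu) as [K2 [hK2 bK2]].
destruct (bounded_continuous v 0 PI cv) as [K3 [hK3 bK3]].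
destruct (bounded_continuous dv 0 PI cdv) as [K4 [hK4 bK4]].
exists (B * (K1 + K2 + K3 + K4)); split; [nra|].
intros t ht; assert (hpi := PI_RGT_0).
(* Between multiples of the period, the solution is a combination of [u] and [v] on [[0, PI]] with
   coefficients the values at [n PI], already bounded by [B]. *)
destruct (nfloor_ex (t / PI)) as [n hn]; [now apply Rdiv_le_0_compat|].
set (r := t - INR n * PI).
assert (et : t / PI * PI = t) by (field; lra).
assert (hr : 0 <= r <= PI) by (unfold r; nra).
assert (hsol := hill_shift x dx n hx).
assert (e1 := solution_eq _ _ hsol r); assert (e2 := solution_derive_eq _ _ hsol r).
cbv beta in e1, e2; rewrite Rplus_0_l in e1, e2.
replace (r + INR n * PI) with t in e1, e2 by (unfold r; ring).
destruct (hX n) as [h1 h2].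
assert (hmul : forall y z w, Rabs y <= B -> Rabs z <= w -> Rabs (y * z) <= B * w).
{ intros y z w hy hz; rewrite Rabs_mult.
  apply Rmult_le_compat; auto using Rabs_pos. }
rewrite e1, e2; split; (eapply Rle_trans; [apply Rabs_triang|]).
- generalize (hmul _ _ _ h1 (bK1 r hr)) (hmul _ _ _ h2 (bK3 r hr)); nra.
- generalize (hmul _ _ _ h1 (bK2 r hr)) (hmul _ _ _ h2 (bK4 r hr)); nra.
Qed.

(** Lyapunov stability is required at every [t0], negative ones included, so the bound is carried to
    negative times by the reflection [t -> - t]. *)
Lemma stable_bounded (x dx : R -> R) : a * a' * (b * b') < 0 ->
  hill_solution p x dx ->
  exists K, 0 <= K /\ forall t, Rabs (x t) <= K /\ Rabs (dx t) <= K.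
Proof.
intros hneg hx.
destruct (stable_bounded_pos x dx hneg hx) as [K [hK bK]].
assert (hr := hill_comp_affine p x dx (-1) 0 ltac:(ring)
  ltac:(intros t; replace (-1 * t + 0) with (- t) by ring; apply p_even) hx).
destruct (stable_bounded_pos _ _ hneg hr) as [K' [hK' bK']].
exists (K + K'); split; [lra|]; intros t; destruct (Rle_dec 0 t) as [ht|ht].
- destruct (bK t ht); lra.
- destruct (bK' (- t) ltac:(lra)) as [h1 h2].
  replace (-1 * - t + 0) with t in h1, h2 by ring.
  replace (-1 * dx t) with (- dx t) in h2 by ring; rewrite Rabs_Ropp in h2; lra.
Qed.

Lemma unstable_unbounded : 0 < a * a' * (b * b') ->
  forall delta, 0 < delta -> exists x dx, hill_solution p x dx /\
    Rabs (x 0) < delta /\ Rabs (dx 0) < delta /\ exists t, 0 <= t /\ 1 <= Rabs (x t).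
Proof.
intros hpos delta hdelta.
set (D := a * b' + a' * b); set (beta := 2 * (b * b')); set (gamma := 2 * (a * a')).
assert (hbg : 0 < beta * gamma) by (unfold beta, gamma; nra).
assert (hdet : D ^ 2 = 1 + beta * gamma)
  by (unfold D, beta, gamma; rewrite <- det_half_period; ring).
(* The eigenvalues are [D + r] with [r] a square root of [beta * gamma]; as [D^2 > 1], giving [r]
   the sign of [D] selects the expanding one. *)
assert (hr : exists r, r * r = beta * gamma /\ 1 < Rabs (D + r)).
{ assert (hs := sqrt_sqrt (beta * gamma) (Rlt_le _ _ hbg)).
  assert (hs0 := sqrt_lt_R0 _ hbg).
  destruct (Rle_dec 0 D).
  - exists (sqrt (beta * gamma)); split; [easy|].
    rewrite Rabs_right by lra; nra.
  - exists (- sqrt (beta * gamma)); split; [lra|].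
    rewrite Rabs_left by lra; nra. }
destruct hr as [r [hr hlam]].
(* [(beta, r)] is an eigenvector of the monodromy matrix for [D + r]. *)
set (eta := delta / (2 * (Rabs beta + Rabs r + 1))).
assert (hden : 0 < Rabs beta + Rabs r + 1)
  by (generalize (Rabs_pos beta) (Rabs_pos r); lra).
assert (heta : 0 < eta) by (apply Rdiv_lt_0_compat; lra).
assert (heq : eta * (Rabs beta + Rabs r + 1) = delta / 2) by (unfold eta; field; lra).
set (x := fun t => eta * beta * u t + eta * r * v t).
set (dx := fun t => eta * beta * du t + eta * r * dv t).
assert (hx : hill_solution p x dx) by now apply hill_lincomb.
assert (hn : forall n, x (INR n * PI) = eta * beta * (D + r) ^ n
   /\ dx (INR n * PI) = eta * r * (D + r) ^ n).
{ induction n as [|n [IH1 IH2]].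
  - simpl INR; rewrite Rmult_0_l; unfold x, dx; rewrite u0, du0, v0, dv0; simpl; split; ring.
  - destruct (monodromy_iter_step x dx n hx) as [-> ->]; rewrite IH1, IH2.
    fold D beta gamma; simpl pow; split; [ring|].
    transitivity (eta * (D + r) ^ n * (D * r + beta * gamma)); [ring|].
    rewrite <- hr; ring. }
exists x, dx; split; [easy|].
destruct (hn 0%nat) as [h1 h2]; simpl in h1, h2; rewrite Rmult_0_l, Rmult_1_r in h1, h2.
rewrite h1, h2, !Rabs_mult, (Rabs_right eta) by lra.
assert (hb := Rabs_pos beta); assert (hr0 := Rabs_pos r).
repeat split; [nra|nra|].
assert (hbeta : beta <> 0) by (intros e; rewrite e in hbg; lra).
assert (hb' := Rabs_pos_lt _ hbeta).
destruct (Pow_x_infinity (D + r) hlam (/ (eta * Rabs beta))) as [N hN].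
exists (INR N * PI); split.
- apply Rmult_le_pos; [apply pos_INR|generalize PI_RGT_0; lra].
- rewrite (proj1 (hn N)), !Rabs_mult, (Rabs_right eta) by lra.
  specialize (hN N (le_n N)).
  assert (hp : 0 < eta * Rabs beta) by now apply Rmult_lt_0_compat.
  apply Rge_le, (Rmult_le_compat_l (eta * Rabs beta)) in hN; [|lra].
  rewrite Rinv_r in hN; lra.
Qed.

End Fundamental.

(** * From Hill's form back to the Mathieu equation *)

Lemma mathieu_coefficient (c s t : R) :
  c + s / 2 + 2 * (s / 4) * cos (2 * t) = hill_potential c s t.
Proof. unfold hill_potential; rewrite cos_2a_cos; field. Qed.

Lemma mathieu_solution_hill (c s : R) (xi : R -> R) :
  mathieu_solution (c + s / 2) (s / 4) xi ->
  hill_solution (hill_potential c s) xi (Derive xi).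
Proof.
intros [hd he] t; destruct (hd t) as [h1 h2]; split; [now apply Derive_correct|].
eapply is_derive_eq; [apply Derive_correct, h2|].
specialize (he t); rewrite mathieu_coefficient in he.
change (Derive_n xi 2 t) with (Derive (Derive xi) t) in he; lra.
Qed.

Lemma hill_mathieu_solution (c s : R) (x dx : R -> R) :
  hill_solution (hill_potential c s) x dx ->
  mathieu_solution (c + s / 2) (s / 4) x /\ forall t, Derive x t = dx t.
Proof.
intros h.
assert (e : forall t, Derive x t = dx t) by (intros t; apply is_derive_unique, h).
assert (h2 : forall t, is_derive (Derive x) t (- (hill_potential c s t * x t))).
{ intros t; apply is_derive_ext with dx; [now intros r|apply h]. }
repeat split; auto.
- exists (dx t); apply h.
- eexists; apply h2.
- intros t; change (Derive_n x 2 t) with (Derive (Derive x) t).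
  rewrite (is_derive_unique _ _ _ (h2 t)), mathieu_coefficient; ring.
Qed.

Lemma hill_potential_even c s t : hill_potential c s (- t) = hill_potential c s t.
Proof. unfold hill_potential; now rewrite cos_neg. Qed.

Lemma hill_potential_periodic c s t : hill_potential c s (t + PI) = hill_potential c s t.
Proof. unfold hill_potential; rewrite neg_cos; ring. Qed.

Section MathieuStability.

Variables (c s : R) (u du v dv : R -> R).
Hypothesis hu : hill_solution (hill_potential c s) u du.
Hypothesis hv : hill_solution (hill_potential c s) v dv.
Hypothesis u0 : u 0 = 1.
Hypothesis du0 : du 0 = 0.
Hypothesis v0 : v 0 = 0.
Hypothesis dv0 : dv 0 = 1.

Lemma mathieu_stable_of_sign :
  u (PI / 2) * du (PI / 2) * (v (PI / 2) * dv (PI / 2)) < 0 ->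
  mathieu_stable (c + s / 2) (s / 4).
Proof.
intros hneg t0 eps heps.
assert (hb := stable_bounded _ u du v dv hu hv u0 du0 v0 dv0
  (hill_potential_even c s) (hill_potential_periodic c s)).
destruct (hb u du hneg hu) as [K1 [hK1 bK1]].
destruct (hb v dv hneg hv) as [K2 [hK2 bK2]].
set (K := K1 + K2).
assert (hK : 0 <= K) by (unfold K; lra).
(* Going from [t0] to [0] costs a factor [2 K], and from [0] to [t] another [2 K]; the [+ 1] makes
   the final inequality strict and covers [K = 0]. *)
exists (eps / (4 * K ^ 2 + 1)).
assert (hden : 0 < 4 * K ^ 2 + 1) by nra.
set (delta := eps / (4 * K ^ 2 + 1)).
assert (hdelta : 0 < delta) by now apply Rdiv_lt_0_compat.
assert (hed : delta * (4 * K ^ 2 + 1) = eps) by (unfold delta; field; lra).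
split; [easy|]; intros xi hxi h1 h2 t _.
apply mathieu_solution_hill in hxi.
assert (hu' : forall r, Rabs (u r) <= K /\ Rabs (du r) <= K)
  by (intros r; generalize (bK1 r); unfold K; lra).
assert (hv' : forall r, Rabs (v r) <= K /\ Rabs (dv r) <= K)
  by (intros r; generalize (bK2 r); unfold K; lra).
assert (hmul : forall y z A, Rabs y <= A -> Rabs z <= K -> Rabs (y * z) <= A * K)
  by (intros; rewrite Rabs_mult; apply Rmult_le_compat; auto using Rabs_pos).
assert (hA : Rabs (xi 0) <= 2 * (delta * K)).
{ rewrite (initial_position _ v dv hv v0 dv0 xi _ hxi t0).
  eapply Rle_trans; [apply Rabs_triang|]; rewrite Rabs_Ropp.
  generalize (hmul _ _ _ (Rlt_le _ _ h1) (proj2 (hv' t0)))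
    (hmul _ _ _ (Rlt_le _ _ h2) (proj1 (hv' t0))); lra. }
assert (hB : Rabs (Derive xi 0) <= 2 * (delta * K)).
{ rewrite (initial_velocity _ u du hu u0 du0 xi _ hxi t0).
  eapply Rle_trans; [apply Rabs_triang|]; rewrite Rabs_Ropp.
  rewrite (Rmult_comm (u t0)), (Rmult_comm (du t0)).
  generalize (hmul _ _ _ (Rlt_le _ _ h2) (proj1 (hu' t0)))
    (hmul _ _ _ (Rlt_le _ _ h1) (proj2 (hu' t0))); lra. }
assert (hlt : 2 * (delta * K) * K + 2 * (delta * K) * K < eps) by nra.
rewrite (solution_eq _ u du v dv hu hv u0 du0 v0 dv0 xi _ hxi t).
rewrite (solution_derive_eq _ u du v dv hu hv u0 du0 v0 dv0 xi _ hxi t).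
split; (eapply Rle_lt_trans; [apply Rabs_triang|]).
- generalize (hmul _ _ _ hA (proj1 (hu' t))) (hmul _ _ _ hB (proj1 (hv' t))); lra.
- generalize (hmul _ _ _ hA (proj2 (hu' t))) (hmul _ _ _ hB (proj2 (hv' t))); lra.
Qed.

Lemma mathieu_unstable_of_sign :
  0 < u (PI / 2) * du (PI / 2) * (v (PI / 2) * dv (PI / 2)) ->
  ~ mathieu_stable (c + s / 2) (s / 4).
Proof.
intros hpos hst.
destruct (hst 0 1 Rlt_0_1) as [delta [hdelta h]].
destruct (unstable_unbounded _ u du v dv hu hv u0 du0 v0 dv0
  (hill_potential_even c s) (hill_potential_periodic c s) hpos delta hdelta)
  as [x [dx [hx [h1 [h2 [t [ht h3]]]]]]].
destruct (hill_mathieu_solution c s x dx hx) as [hm e].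
rewrite <- e in h2.
destruct (h x hm h1 h2 t ht); lra.
Qed.

End MathieuStability.

(** * Dependence of the angles on the parameter *)

(** To leave the interval, [f] would have to take a value [pi/2] or [- pi/2], where [cos] vanishes.
    This turns the sign of a Wronskian-like expression into a bound on a difference of angles. *)
Lemma cos_pos_trapped (f : R -> R) :
  (forall t : R, continuous f t) -> f 0 = 0 -> (forall t, 0 < cos (f t)) ->
  forall t, - (PI / 2) < f t < PI / 2.
Proof.
intros hf f0 hcos t.
assert (hc : continuity f) by (intros x; apply continuity_pt_filterlim, hf).
assert (hpi := PI_RGT_0).
split; apply Rnot_le_lt; intros h.
- destruct (IVT_gen f 0 t (- (PI / 2)) hc) as [x [_ e]].
  { rewrite f0, Rmin_right, Rmax_left; lra. }
  specialize (hcos x); rewrite e, cos_neg, cos_PI2 in hcos; lra.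
- destruct (IVT_gen f 0 t (PI / 2) hc) as [x [_ e]].
  { rewrite f0, Rmin_left, Rmax_right; lra. }
  specialize (hcos x); rewrite e, cos_PI2 in hcos; lra.
Qed.

Lemma phase_continuous p phi : is_phase p phi -> forall t : R, continuous phi t.
Proof. intros h t; eapply is_derive_continuous, h. Qed.

Lemma phase_nondecreasing p phi x y : is_phase p phi -> (forall t, 0 <= p t) ->
  x <= y -> phi x <= phi y.
Proof.
intros h hp hxy.
apply derive_nonneg_le with (df := fun t => sin (phi t) ^ 2 + p t * cos (phi t) ^ 2).
- easy.
- intros; apply h.
- intros t _; apply Rplus_le_le_0_compat; [apply pow2_ge_0|].
  apply Rmult_le_pos; [apply hp|apply pow2_ge_0].
Qed.

Lemma hill_constant_cos (p : R -> R) (k : R) : (forall t, p t = k ^ 2) ->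
  hill_solution p (fun t => cos (k * t)) (fun t => - k * sin (k * t)).
Proof. intros hp t; rewrite hp; split; auto_derive; auto; ring. Qed.

Lemma hill_constant_sin (p : R -> R) (k : R) : 0 < k -> (forall t, p t = k ^ 2) ->
  hill_solution p (fun t => sin (k * t) / k) (fun t => cos (k * t)).
Proof. intros hk hp t; rewrite hp; split; auto_derive; auto; field; lra. Qed.

Lemma hill_constant_eq (p x dx : R -> R) (k t : R) : 0 < k -> (forall t, p t = k ^ 2) ->
  hill_solution p x dx ->
  x t = x 0 * cos (k * t) + dx 0 * (sin (k * t) / k) /\
  dx t = x 0 * (- k * sin (k * t)) + dx 0 * cos (k * t).
Proof.
intros hk hp hx.
assert (hc := hill_constant_cos p k hp); assert (hs := hill_constant_sin p k hk hp).
split.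
- apply (solution_eq p _ _ _ _ hc hs); auto; rewrite Rmult_0_r, ?cos_0, ?sin_0; lra.
- apply (solution_derive_eq p _ _ _ _ hc hs); auto; rewrite Rmult_0_r, ?cos_0, ?sin_0; lra.
Qed.

(** The solution is [cos (k t)], so [rho cos (phi - k t) = cos^2 (k t) + k sin^2 (k t) > 0]: the
    angle never drifts from [k t] by a quarter turn. *)
Lemma constant_phase_lower (p phi : R -> R) (k t : R) : 0 < k -> (forall t, p t = k ^ 2) ->
  is_phase p phi -> phi 0 = 0 -> k * t - PI / 2 < phi t.
Proof.
intros hk hp hphi h0.
assert (hpc : forall r : R, continuous p r).
{ intros r; apply (continuous_ext (fun _ => k ^ 2)); [easy|apply continuous_const]. }
destruct (phase_hill p phi hpc hphi) as [rho [hr0 [hrho hsol]]].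
enough (h : - (PI / 2) < phi t - k * t < PI / 2) by lra.
apply (cos_pos_trapped (fun t => phi t - k * t)).
- intros r; apply (continuous_minus phi (fun t => k * t)).
  + now apply phase_continuous with p.
  + apply (ex_derive_continuous (fun t => k * t)); auto_derive; easy.
- rewrite h0; ring.
- intros r; destruct (hill_constant_eq p _ _ k r hk hp hsol) as [e1 e2].
  cbv beta in e1, e2; rewrite h0, hr0, cos_0, sin_0 in e1, e2.
  apply (Rmult_lt_reg_l (rho r)); [apply hrho|]; rewrite Rmult_0_r, cos_minus.
  replace (rho r * _) with ((rho r * cos (phi r)) * cos (k * r)
    - (- (rho r * sin (phi r))) * sin (k * r)) by ring.
  rewrite e1, e2.
  assert (e := cos_sq_sin_sq (k * r)).
  assert (h1 := pow2_ge_0 (cos (k * r))); assert (h2 := pow2_ge_0 (sin (k * r))).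
  assert (0 <= k * sin (k * r) ^ 2) by (apply Rmult_le_pos; lra).
  replace (_ - _) with (cos (k * r) ^ 2 + k * sin (k * r) ^ 2) by ring.
  destruct (Req_dec (sin (k * r)) 0) as [e0|e0].
  + rewrite e0 in *; lra.
  + assert (0 < sin (k * r) ^ 2) by (apply pow2_gt_0; easy).
    assert (0 < k * sin (k * r) ^ 2) by (apply Rmult_lt_0_compat; lra); lra.
Qed.

Lemma hill_potential_bound (c s t : R) : Rabs (hill_potential c s t) <= Rabs c + Rabs s.
Proof.
unfold hill_potential; eapply Rle_trans; [apply Rabs_triang|].
apply Rplus_le_compat_l; rewrite Rabs_mult, (Rabs_right (_ ^ 2)) by apply Rle_ge, pow2_ge_0.
assert (cos t ^ 2 <= 1) by (rewrite cos_sq_sin_sq; generalize (pow2_ge_0 (sin t)); lra).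
generalize (Rabs_pos s); nra.
Qed.

Lemma hill_potential_nonneg (c s t : R) : 0 <= c -> 0 <= s -> 0 <= hill_potential c s t.
Proof.
intros hc hs; apply Rplus_le_le_0_compat; [easy|].
apply Rmult_le_pos; [easy|apply pow2_ge_0].
Qed.

Definition hill_phase (c s phi0 : R) : R -> R :=
  proj1_sig (phase_exists (hill_potential c s) _ phi0
    (continuous_hill_potential c s) (hill_potential_bound c s)).

Lemma hill_phase_0 c s phi0 : hill_phase c s phi0 0 = phi0.
Proof. unfold hill_phase; destruct phase_exists as [phi h]; apply h. Qed.

Lemma hill_phase_is_phase c s phi0 : is_phase (hill_potential c s) (hill_phase c s phi0).
Proof. unfold hill_phase; destruct phase_exists as [phi h]; apply h. Qed.

Lemma hill_potential_le c s1 s2 t : s1 <= s2 ->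
  hill_potential c s1 t <= hill_potential c s2 t <= hill_potential c s1 t + (s2 - s1).
Proof.
intros h; unfold hill_potential; assert (h1 := pow2_ge_0 (cos t)).
assert (cos t ^ 2 <= 1) by (rewrite cos_sq_sin_sq; generalize (pow2_ge_0 (sin t)); lra).
nra.
Qed.

Lemma hill_potential_one_minus_bound c s t :
  Rabs (1 - hill_potential c s t) <= 1 + Rabs c + Rabs s.
Proof.
eapply Rle_trans; [apply Rabs_triang|]; rewrite Rabs_R1, Rabs_Ropp.
generalize (hill_potential_bound c s t); lra.
Qed.

Lemma hill_phase_increasing c phi0 s1 s2 : s1 < s2 ->
  hill_phase c s1 phi0 (PI / 2) < hill_phase c s2 phi0 (PI / 2).
Proof.
intros h; assert (hpi := PI_RGT_0).
apply (phase_lt (hill_potential c s1) (hill_potential c s2) _ _ (1 + Rabs c + Rabs s2)).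
- apply hill_phase_is_phase.
- apply hill_phase_is_phase.
- now rewrite !hill_phase_0.
- intros t _; apply hill_potential_le; lra.
- intros t _; apply hill_potential_one_minus_bound.
- lra.
- intros t ht; unfold hill_potential.
  assert (0 < cos t) by (apply cos_gt_0; lra).
  assert (0 < cos t ^ 2) by (apply pow_lt; lra); nra.
Qed.

(** The separate bound [B] keeps the exponential constant fixed while the parameter varies near a
    point. *)
Lemma hill_phase_lip c phi0 s1 s2 B : s1 <= s2 -> Rabs s2 <= B ->
  hill_phase c s2 phi0 (PI / 2) - hill_phase c s1 phi0 (PI / 2)
  <= (s2 - s1) * exp ((1 + Rabs c + B) * (PI / 2)).
Proof.
intros h hB; assert (hpi := PI_RGT_0).
apply (phase_diff_upper (hill_potential c s1) (hill_potential c s2)).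
- apply hill_phase_is_phase.
- apply hill_phase_is_phase.
- now rewrite !hill_phase_0.
- intros t _; apply hill_potential_le; lra.
- intros t _; generalize (hill_potential_one_minus_bound c s2 t); lra.
- lra.
- generalize (Rabs_pos c) (Rabs_pos s2); lra.
- intros t _; generalize (hill_potential_le c s1 s2 t h); lra.
Qed.

Lemma hill_phase_continuity c phi0 :
  continuity (fun s => hill_phase c s phi0 (PI / 2)).
Proof.
intros s0; apply continuity_pt_filterlim, filterlim_locally; intros eps.
set (K := exp ((1 + Rabs c + (Rabs s0 + 1)) * (PI / 2))).
assert (hK : 0 < K) by apply exp_pos.
assert (hd : 0 < Rmin 1 (eps / K))
  by (apply Rmin_pos; [lra|apply Rdiv_lt_0_compat; [apply cond_pos|easy]]).
exists (mkposreal _ hd); intros s hs; apply Rabs_lt_between' in hs; simpl in hs.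
apply Rabs_lt_between'.
assert (h1 := Rmin_l 1 (eps / K)); assert (h2 := Rmin_r 1 (eps / K)).
assert (he : eps / K * K = eps) by (field; lra).
assert (hb : Rabs s <= Rabs s0 + 1).
{ replace s with (s0 + (s - s0)) by ring.
  eapply Rle_trans; [apply Rabs_triang|]; apply Rplus_le_compat_l, Rabs_le; lra. }
assert (hb0 : Rabs s0 <= Rabs s0 + 1) by lra.
destruct (Rtotal_order s s0) as [h|[->|h]].
- assert (hi := hill_phase_increasing c phi0 s s0 h).
  assert (hl := hill_phase_lip c phi0 s s0 _ (Rlt_le _ _ h) hb0); fold K in hl.
  assert ((s0 - s) * K < eps) by (rewrite <- he; apply Rmult_lt_compat_r; lra); lra.
- assert (hp := cond_pos eps); lra.
- assert (hi := hill_phase_increasing c phi0 s0 s h).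
  assert (hl := hill_phase_lip c phi0 s0 s _ (Rlt_le _ _ h) hb); fold K in hl.
  assert ((s - s0) * K < eps) by (rewrite <- he; apply Rmult_lt_compat_r; lra); lra.
Qed.

(** On [[0, pi/4]] one has [cos^2 t >= 1/2], so the potential with [s = 2 k^2] dominates the
    constant [k^2]; on the rest of the half period the angle does not decrease. *)
Lemma hill_phase_lower c k : 0 <= c -> 0 < k ->
  k * (PI / 4) - PI / 2 < hill_phase c (2 * k ^ 2) 0 (PI / 2).
Proof.
intros hc hk; assert (hpi := PI_RGT_0).
assert (hk2 := pow2_ge_0 k).
destruct (phase_exists (fun _ => k ^ 2) (k ^ 2) 0) as [phi [h0 hphi]].
{ intros t; apply continuous_const. }
{ intros t; rewrite Rabs_right; lra. }
apply Rlt_le_trans with (phi (PI / 4)).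
{ now apply constant_phase_lower with (fun _ => k ^ 2). }
apply Rle_trans with (hill_phase c (2 * k ^ 2) 0 (PI / 4)).
- apply (phase_le (fun _ => k ^ 2) (hill_potential c (2 * k ^ 2)) _ _
    (1 + Rabs c + Rabs (2 * k ^ 2)) (PI / 4)).
  + easy.
  + apply hill_phase_is_phase.
  + now rewrite hill_phase_0.
  + intros t ht; unfold hill_potential.
    assert (h : 0 <= cos (2 * t)) by (apply cos_ge_0; lra).
    rewrite cos_2a_cos in h.
    assert (0 <= k ^ 2 * (2 * cos t * cos t - 1)) by (apply Rmult_le_pos; lra).
    lra.
  + intros t _; apply hill_potential_one_minus_bound.
  + lra.
- apply phase_nondecreasing with (hill_potential c (2 * k ^ 2)).
  + apply hill_phase_is_phase.
  + intros t; apply hill_potential_nonneg; lra.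
  + lra.
Qed.

(** * Half-period data in terms of the two angles *)

Section HalfPeriod.

Variables c s : R.

Let p := hill_potential c s.
Let phi := hill_phase c s 0.
Let psi := hill_phase c s (- (PI / 2)).

Lemma hill_fundamental : exists u du v dv : R -> R,
  (hill_solution p u du /\ hill_solution p v dv) /\
  (u 0 = 1 /\ du 0 = 0 /\ v 0 = 0 /\ dv 0 = 1) /\
  forall t, exists rho sigma, 0 < rho /\ 0 < sigma /\
    (u t = rho * cos (phi t) /\ du t = - (rho * sin (phi t))) /\
    (v t = sigma * cos (psi t) /\ dv t = - (sigma * sin (psi t))).
Proof.
destruct (phase_hill p phi (continuous_hill_potential c s) (hill_phase_is_phase c s 0))
  as [rho [hr0 [hrho hu]]].
destruct (phase_hill p psi (continuous_hill_potential c s)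
  (hill_phase_is_phase c s (- (PI / 2)))) as [sigma [hs0 [hsigma hv]]].
do 4 eexists; split; [split; [exact hu|exact hv]|]; split.
- unfold phi, psi; rewrite !hill_phase_0, hr0, hs0, cos_neg, sin_neg.
  rewrite cos_0, sin_0, cos_PI2, sin_PI2; repeat split; ring.
- intros t; exists (rho t), (sigma t); repeat split; auto.
Qed.

(** The Wronskian is [rho sigma sin (phi - psi) = 1], so the cosine of [phi - (psi + pi/2)] stays
    positive from its initial angle [0] on. *)
Lemma phase_gap : - (PI / 2) < phi (PI / 2) - (psi (PI / 2) + PI / 2) < PI / 2.
Proof.
destruct hill_fundamental as [u [du [v [dv [[hu hv] [[u0 [du0 [v0 dv0]]] hpol]]]]]].
apply (cos_pos_trapped (fun t => phi t - (psi t + PI / 2))).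
- intros t; apply (continuous_minus phi (fun t => psi t + PI / 2)).
  + apply (phase_continuous p), hill_phase_is_phase.
  + apply (continuous_plus psi (fun _ => PI / 2)); [|apply continuous_const].
    apply (phase_continuous p), hill_phase_is_phase.
- unfold phi, psi; rewrite !hill_phase_0; field.
- intros t; destruct (hpol t) as [rho [sigma [hr [hs [[e1 e2] [e3 e4]]]]]].
  assert (h := fundamental_wronskian p u du v dv hu hv u0 du0 v0 dv0 t).
  rewrite e1, e2, e3, e4 in h.
  replace (phi t - (psi t + PI / 2)) with (- (PI / 2 - (phi t - psi t))) by ring.
  rewrite cos_neg, cos_shift, sin_minus.
  apply (Rmult_lt_reg_l (rho * sigma)); [now apply Rmult_lt_0_compat|].
  rewrite Rmult_0_r; apply Rlt_le_trans with 1; [lra|right; rewrite <- h; ring].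
Qed.

(** The shift by [PI] lets both doubled angles start from [0]. It changes one sign, so the product
    of sines is opposite to [a a' b b']. *)
Lemma stability_by_phases :
  (0 < sin (2 * phi (PI / 2)) * sin (2 * psi (PI / 2) + PI) ->
     mathieu_stable (c + s / 2) (s / 4)) /\
  (sin (2 * phi (PI / 2)) * sin (2 * psi (PI / 2) + PI) < 0 ->
     ~ mathieu_stable (c + s / 2) (s / 4)).
Proof.
destruct hill_fundamental as [u [du [v [dv [[hu hv] [[u0 [du0 [v0 dv0]]] hpol]]]]]].
destruct (hpol (PI / 2)) as [rho [sigma [hr [hs [[e1 e2] [e3 e4]]]]]].
assert (e : u (PI / 2) * du (PI / 2) * (v (PI / 2) * dv (PI / 2))
  = - ((rho * sigma / 2) ^ 2 * (sin (2 * phi (PI / 2)) * sin (2 * psi (PI / 2) + PI)))).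
{ rewrite neg_sin, !sin_2a, e1, e2, e3, e4; field. }
assert (hp : 0 < (rho * sigma / 2) ^ 2) by (apply pow_lt; nra).
split; intros h.
- apply (mathieu_stable_of_sign c s u du v dv); auto.
  rewrite e; generalize (Rmult_lt_0_compat _ _ hp h); lra.
- apply (mathieu_unstable_of_sign c s u du v dv); auto.
  rewrite e; assert (h' := Rmult_lt_0_compat _ _ hp (Ropp_gt_lt_0_contravar _ h)); lra.
Qed.

(** The sines vanish when [u u' = 0] and [v v' = 0] at [pi/2]. The Wronskian excludes [u = v = 0]
    and [u' = v' = 0]; the two mixed cases are the periodic and antiperiodic coexistence. *)
Lemma phases_not_both_critical : s <> 0 ->
  sin (2 * phi (PI / 2)) = 0 -> sin (2 * psi (PI / 2) + PI) = 0 -> False.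
Proof.
intros hs0 h1 h2.
destruct hill_fundamental as [u [du [v [dv [[hu hv] [[u0 [du0 [v0 dv0]]] hpol]]]]]].
destruct (hpol (PI / 2)) as [rho [sigma [hr [hs [[e1 e2] [e3 e4]]]]]].
rewrite neg_sin in h2; rewrite sin_2a in h1, h2.
assert (hw := fundamental_wronskian p u du v dv hu hv u0 du0 v0 dv0 (PI / 2)).
assert (huz : u (PI / 2) = 0 \/ du (PI / 2) = 0).
{ apply Rmult_integral; rewrite e1, e2.
  transitivity (- (rho * rho / 2) * (2 * sin (phi (PI / 2)) * cos (phi (PI / 2))));
    [field|rewrite h1; ring]. }
assert (hvz : v (PI / 2) = 0 \/ dv (PI / 2) = 0).
{ apply Rmult_integral; rewrite e3, e4.
  transitivity ((sigma * sigma / 2) * - (2 * sin (psi (PI / 2)) * cos (psi (PI / 2))));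
    [field|rewrite h2; ring]. }
destruct huz as [hz|hz], hvz as [hz'|hz'].
- rewrite hz, hz' in hw; lra.
- apply (no_coexistence_antiperiodic c s u du v dv); auto.
- apply (no_coexistence_periodic c s u du v dv); auto.
- rewrite hz, hz' in hw; lra.
Qed.

(** For the explicit trigonometric solutions [u u' = - k^2 v v']. The positive factor [r] is what
    later places both angles in the same cell at [s = 0]. *)
Lemma phases_unperturbed (k : R) : 0 < k -> (forall t, p t = k ^ 2) ->
  exists r, 0 < r /\ sin (2 * phi (PI / 2)) = r * sin (2 * psi (PI / 2) + PI).
Proof.
intros hk hp.
destruct hill_fundamental as [u [du [v [dv [[hu hv] [[u0 [du0 [v0 dv0]]] hpol]]]]]].
destruct (hpol (PI / 2)) as [rho [sigma [hr [hs [[e1 e2] [e3 e4]]]]]].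
destruct (hill_constant_eq p u du k (PI / 2) hk hp hu) as [f1 f2].
destruct (hill_constant_eq p v dv k (PI / 2) hk hp hv) as [f3 f4].
rewrite u0, du0 in f1, f2; rewrite v0, dv0 in f3, f4.
assert (h : u (PI / 2) * du (PI / 2) = - k ^ 2 * (v (PI / 2) * dv (PI / 2)))
  by (rewrite f1, f2, f3, f4; field; lra).
exists ((k * sigma / rho) ^ 2); split.
- apply pow_lt, Rdiv_lt_0_compat; [now apply Rmult_lt_0_compat|easy].
- rewrite e1, e2, e3, e4 in h; rewrite neg_sin, !sin_2a.
  apply (Rmult_eq_reg_l (rho ^ 2)); [|apply pow_nonzero; lra].
  transitivity (-2 * (rho * cos (phi (PI / 2)) * - (rho * sin (phi (PI / 2))))); [ring|].
  rewrite h; field; lra.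
Qed.

End HalfPeriod.

(** * Alternation *)

Lemma sin_PI_sign (n : nat) (x : R) :
  INR n < x < INR n + 1 -> 0 < (-1) ^ n * sin (PI * x).
Proof.
assert (hpi := PI_RGT_0); revert x; induction n as [|n IH]; intros x hx.
- simpl in *; rewrite Rmult_1_l; apply sin_gt_0; nra.
- rewrite S_INR in hx.
  replace (PI * x) with (PI * (x - 1) + PI) by ring; rewrite neg_sin; simpl.
  specialize (IH (x - 1) ltac:(lra)); lra.
Qed.

Lemma sin_PI_INR (n : nat) : sin (PI * INR n) = 0.
Proof. apply sin_eq_0_1; exists (Z.of_nat n); rewrite <- INR_IZR_INZ; ring. Qed.

Lemma sign_sq (n : nat) : (-1) ^ n * (-1) ^ n = 1.
Proof. rewrite <- Rpow_mult_distr; replace (-1 * -1) with 1 by ring; apply pow1. Qed.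

Lemma sin_PI_same_cell (n : nat) (x y : R) :
  INR n < x < INR n + 1 -> INR n < y < INR n + 1 -> 0 < sin (PI * x) * sin (PI * y).
Proof.
intros hx hy.
generalize (Rmult_lt_0_compat _ _ (sin_PI_sign n x hx) (sin_PI_sign n y hy)).
replace ((-1) ^ n * sin (PI * x) * ((-1) ^ n * sin (PI * y)))
  with ((-1) ^ n * (-1) ^ n * (sin (PI * x) * sin (PI * y))) by ring.
rewrite sign_sq; lra.
Qed.

Lemma sin_PI_next_cell (n : nat) (x y : R) :
  INR n < x < INR n + 1 -> INR n + 1 < y < INR n + 2 -> sin (PI * x) * sin (PI * y) < 0.
Proof.
intros hx hy.
assert (h := sin_PI_same_cell n x (y - 1) hx ltac:(lra)).
replace (PI * y) with (PI * (y - 1) + PI) by ring; rewrite neg_sin; lra.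
Qed.

(** If [y] were inside the next cell the sines would have opposite signs; if [y] were the integer
    between, [sin (PI x)] would vanish inside a cell. Positive proportionality forbids both. *)
Lemma floors_agree_le (x y r : R) : 0 <= x -> x <= y -> y < x + 1 -> 0 < r ->
  sin (PI * x) = r * sin (PI * y) ->
  exists n, INR n <= x < INR n + 1 /\ INR n <= y < INR n + 1.
Proof.
intros hx hxy hyx hr e.
destruct (nfloor_ex x hx) as [n hn]; exists n; split; [easy|]; split; [lra|].
apply Rnot_le_lt; intros hy.
assert (hnx : INR n < x) by lra.
destruct (Rle_lt_or_eq_dec _ _ hy) as [h|h].
- assert (h' := sin_PI_next_cell n x y ltac:(lra) ltac:(lra)); rewrite e in h'.
  assert (0 <= r * (sin (PI * y)) ^ 2)
    by (apply Rmult_le_pos; [lra|apply pow2_ge_0]); lra.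
- rewrite <- h, <- S_INR, sin_PI_INR, Rmult_0_r in e.
  assert (h' := sin_PI_sign n x ltac:(lra)); rewrite e in h'; lra.
Qed.

Lemma floors_agree (x y r : R) : 0 <= x -> 0 <= y -> -1 < x - y < 1 -> 0 < r ->
  sin (PI * x) = r * sin (PI * y) ->
  exists n, INR n <= x < INR n + 1 /\ INR n <= y < INR n + 1.
Proof.
intros hx hy hxy hr e; destruct (Rle_dec x y) as [h|h].
- apply (floors_agree_le x y r); lra || easy.
- destruct (floors_agree_le y x (/ r)) as [n hn]; try lra.
  + now apply Rinv_0_lt_compat.
  + rewrite e, <- Rmult_assoc, Rinv_l; lra.
  + now exists n.
Qed.

Section Alternation.

Variables (X Y : R -> R) (m : nat).
Hypothesis X_cont : continuity X.
Hypothesis Y_cont : continuity Y.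
Hypothesis X_incr : forall r s, r < s -> X r < X s.
Hypothesis Y_incr : forall r s, r < s -> Y r < Y s.
Hypothesis X_unbounded : forall A, {s | 0 < s /\ A <= X s}.
Hypothesis XY : forall s, -1 < X s - Y s < 1.
Hypothesis X0 : INR m <= X 0 < INR m + 1.
Hypothesis Y0 : INR m <= Y 0 < INR m + 1.
Hypothesis XY_critical : forall s, 0 < s -> sin (PI * X s) = 0 -> sin (PI * Y s) = 0 -> False.

Lemma level_exists (Z : R -> R) : continuity Z ->
  (forall A, {s | 0 < s /\ A <= Z s}) -> Z 0 < INR m + 1 ->
  forall n, {s | Z s = INR (m + 1 + n)}.
Proof.
intros hZ hun h0 n.
destruct (hun (INR (m + 1 + n))) as [s [hs h]].
assert (hmn : INR m + 1 <= INR (m + 1 + n))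
  by (rewrite !plus_INR; generalize (pos_INR n); simpl; lra).
destruct (IVT_gen Z 0 s (INR (m + 1 + n)) hZ) as [r [_ hr]]; [|now exists r].
rewrite Rmin_left, Rmax_right; lra.
Qed.

Lemma Y_unbounded A : {s | 0 < s /\ A <= Y s}.
Proof. destruct (X_unbounded (A + 1)) as [s hs]; exists s; generalize (XY s); lra. Qed.

Let x n := proj1_sig (level_exists X X_cont X_unbounded (proj2 X0) n).
Let y n := proj1_sig (level_exists Y Y_cont Y_unbounded (proj2 Y0) n).

Lemma incr_reflect (Z : R -> R) r s : (forall r s, r < s -> Z r < Z s) -> Z r < Z s -> r < s.
Proof.
intros hZ h; destruct (Rtotal_order r s) as [h'|[->|h']]; [easy|lra|].
apply hZ in h'; lra.
Qed.

Lemma X_level n : X (x n) = INR m + 1 + INR n.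
Proof. unfold x; destruct level_exists as [s hs]; simpl; now rewrite hs, !plus_INR. Qed.

Lemma Y_level n : Y (y n) = INR m + 1 + INR n.
Proof. unfold y; destruct level_exists as [s hs]; simpl; now rewrite hs, !plus_INR. Qed.

(** The hypotheses do not tell which of [X] and [Y] reaches a given integer first, and this may
    change with the integer; hence the minimum and maximum of each pair of crossings. *)
Definition alternation_points (j : nat) : R :=
  match j with
  | 0%nat => 0
  | S j => if Nat.even j then Rmin (x (Nat.div2 j)) (y (Nat.div2 j))
           else Rmax (x (Nat.div2 j)) (y (Nat.div2 j))
  end.

Lemma alternation_points_odd n : alternation_points (2 * n + 1) = Rmin (x n) (y n).
Proof.
rewrite Nat.add_1_r; unfold alternation_points.
now rewrite Nat.div2_double, Nat.even_mul.
Qed.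

Lemma alternation_points_even n : alternation_points (2 * n + 2) = Rmax (x n) (y n).
Proof.
replace (2 * n + 2)%nat with (S (S (2 * n))) by lia; unfold alternation_points.
now rewrite Nat.div2_succ_double, Nat.even_succ, Nat.odd_mul.
Qed.

Lemma levels_distinct n : x n <> y n.
Proof.
intros e; apply (XY_critical (x n)).
- apply (incr_reflect X); [easy|]; rewrite X_level; generalize (pos_INR n); lra.
- rewrite X_level; replace (INR m + 1 + INR n) with (INR (m + 1 + n))
    by (rewrite !plus_INR; simpl; ring); apply sin_PI_INR.
- rewrite e, Y_level; replace (INR m + 1 + INR n) with (INR (m + 1 + n))
    by (rewrite !plus_INR; simpl; ring); apply sin_PI_INR.
Qed.

(** The mixed comparisons rest on [|X - Y| < 1]: when one function reaches the next integer, the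
    other has already passed the previous one. *)
Lemma levels_separated n : Rmax (x n) (y n) < Rmin (x (S n)) (y (S n)).
Proof.
assert (hX := X_level n); assert (hX' := X_level (S n)).
assert (hY := Y_level n); assert (hY' := Y_level (S n)); rewrite S_INR in hX', hY'.
apply Rmax_lub_lt; apply Rmin_glb_lt.
- apply (incr_reflect X); [easy|lra].
- apply (incr_reflect X); [easy|]; generalize (XY (y (S n))); lra.
- apply (incr_reflect Y); [easy|]; generalize (XY (x (S n))); lra.
- apply (incr_reflect Y); [easy|lra].
Qed.

Lemma alternation_points_incr j : alternation_points j < alternation_points (S j).
Proof.
destruct (Nat.Even_or_Odd j) as [[n ->]|[n ->]].
- destruct n as [|n].
  + change (0 < alternation_points (2 * 0 + 1)); rewrite alternation_points_odd.
    apply Rmin_glb_lt; [apply (incr_reflect X)|apply (incr_reflect Y)]; try easy.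
    * rewrite X_level; simpl; lra.
    * rewrite Y_level; simpl; lra.
  + replace (S (2 * S n)) with (2 * S n + 1)%nat by lia.
    replace (2 * S n)%nat with (2 * n + 2)%nat at 1 by lia.
    rewrite alternation_points_odd, alternation_points_even; apply levels_separated.
- replace (S (2 * n + 1)) with (2 * n + 2)%nat by lia.
  rewrite alternation_points_odd, alternation_points_even.
  generalize (levels_distinct n) (Rmin_l (x n) (y n)) (Rmin_r (x n) (y n))
    (Rmax_l (x n) (y n)) (Rmax_r (x n) (y n)).
  intros h ? ? ? ?; destruct (Rdichotomy _ _ h); lra.
Qed.

Lemma alternation_points_diverge : is_lim_seq alternation_points p_infty.
Proof.
apply is_lim_seq_spec; intros A.
(* The [+ 1] makes [n > |X A|], so the level [m + 1 + n] exceeds [X A + 1] and thus also [Y A]. *)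
destruct (nfloor_ex (Rabs (X A) + 1)) as [n hn]; [generalize (Rabs_pos (X A)); lra|].
exists (2 * n + 1)%nat; intros j hj.
apply Rlt_le_trans with (alternation_points (2 * n + 1)).
- rewrite alternation_points_odd.
  assert (h := Rle_abs (X A)); assert (hm := pos_INR m); assert (hXY := XY A).
  apply Rmin_glb_lt.
  + apply (incr_reflect X); [easy|]; rewrite X_level; lra.
  + apply (incr_reflect Y); [easy|]; rewrite Y_level; lra.
- induction hj as [|j hj IH]; [lra|].
  generalize (alternation_points_incr j); lra.
Qed.

Lemma same_sign_between k s :
  alternation_points (2 * k) < s < alternation_points (2 * k + 1) ->
  0 < s /\ 0 < sin (PI * X s) * sin (PI * Y s).
Proof.
rewrite alternation_points_odd; intros [h1 h2].
assert (hx : s < x k) by (generalize (Rmin_l (x k) (y k)); lra).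
assert (hy : s < y k) by (generalize (Rmin_r (x k) (y k)); lra).
apply X_incr in hx; apply Y_incr in hy; rewrite X_level in hx; rewrite Y_level in hy.
enough (h : 0 < s /\ INR (m + k) < X s /\ INR (m + k) < Y s).
{ split; [easy|]; rewrite plus_INR in h.
  apply (sin_PI_same_cell (m + k)); rewrite plus_INR; lra. }
rewrite plus_INR; destruct k as [|k].
- change (0 < s) in h1; simpl; assert (hx0 := X_incr _ _ h1); assert (hy0 := Y_incr _ _ h1); lra.
- replace (2 * S k)%nat with (2 * k + 2)%nat in h1 by lia.
  rewrite alternation_points_even in h1; rewrite S_INR.
  assert (hx' : x k < s) by (generalize (Rmax_l (x k) (y k)); lra).
  assert (hy' : y k < s) by (generalize (Rmax_r (x k) (y k)); lra).
  assert (h0 : 0 < x k).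
  { apply (incr_reflect X); [easy|]; rewrite X_level; generalize (pos_INR k); lra. }
  assert (hs : 0 < s) by lra.
  apply X_incr in hx'; apply Y_incr in hy'; rewrite X_level in hx'; rewrite Y_level in hy'; lra.
Qed.

(** One function has passed [m + k + 1] and the other has not; [|X - Y| < 1] keeps them in the two
    cells adjacent to that integer. *)
Lemma opposite_sign_between k s :
  alternation_points (2 * k + 1) < s < alternation_points (2 * k + 2) ->
  sin (PI * X s) * sin (PI * Y s) < 0.
Proof.
rewrite alternation_points_odd, alternation_points_even; intros [h1 h2].
assert (e : INR (m + k) = INR m + INR k) by apply plus_INR.
assert (hXY := XY s).
destruct (Rdichotomy _ _ (levels_distinct k)) as [h|h].
- rewrite Rmin_left in h1 by lra; rewrite Rmax_right in h2 by lra.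
  assert (hX := X_incr _ _ h1); assert (hY := Y_incr _ _ h2).
  assert (hXY' := XY (x k)); assert (hY' := Y_incr _ _ h1).
  rewrite X_level in *; rewrite Y_level in *; rewrite Rmult_comm.
  apply (sin_PI_next_cell (m + k)); lra.
- rewrite Rmin_right in h1 by lra; rewrite Rmax_left in h2 by lra.
  assert (hY := Y_incr _ _ h1); assert (hX := X_incr _ _ h2).
  assert (hXY' := XY (y k)); assert (hX' := X_incr _ _ h1).
  rewrite X_level in *; rewrite Y_level in *.
  apply (sin_PI_next_cell (m + k)); lra.
Qed.

End Alternation.

(** * Alternation in the parameter [s] and transfer to the energy *)

Lemma hill_alternation (k : R) : 0 < k ->
  exists S : nat -> R, (forall n, S n < S (n + 1)%nat) /\ is_lim_seq S p_infty /\ S 0%nat = 0 /\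
    forall s, 0 < s ->
    ((exists n, S (2 * n)%nat < s < S (2 * n + 1)%nat) ->
       mathieu_stable (k ^ 2 + s / 2) (s / 4)) /\
    ((exists n, S (2 * n + 1)%nat < s < S (2 * n + 2)%nat) ->
       ~ mathieu_stable (k ^ 2 + s / 2) (s / 4)).
Proof.
intros hk; assert (hpi := PI_RGT_0).
assert (hk2 : 0 <= k ^ 2) by apply pow2_ge_0.
set (X := fun s => hill_phase (k ^ 2) s 0 (PI / 2) * (2 / PI)).
set (Y := fun s => (hill_phase (k ^ 2) s (- (PI / 2)) (PI / 2) + PI / 2) * (2 / PI)).
assert (hq : 0 < 2 / PI) by (apply Rdiv_lt_0_compat; lra).
assert (hq1 : PI / 2 * (2 / PI) = 1) by (field; lra).
assert (eX : forall s, PI * X s = 2 * hill_phase (k ^ 2) s 0 (PI / 2))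
  by (intros s; unfold X; field; lra).
assert (eY : forall s, PI * Y s = 2 * hill_phase (k ^ 2) s (- (PI / 2)) (PI / 2) + PI)
  by (intros s; unfold Y; field; lra).
assert (X_cont : continuity X).
{ intros s; apply (continuity_pt_mult _ (fun _ => 2 / PI)); [apply hill_phase_continuity|].
  apply continuity_pt_const; now intros ? ?. }
assert (Y_cont : continuity Y).
{ intros s; apply (continuity_pt_mult
    (fun s => hill_phase (k ^ 2) s (- (PI / 2)) (PI / 2) + PI / 2) (fun _ => 2 / PI)).
  - apply (continuity_pt_plus _ (fun _ => PI / 2)); [apply hill_phase_continuity|].
    apply continuity_pt_const; now intros ? ?.
  - apply continuity_pt_const; now intros ? ?. }
assert (X_incr : forall r s, r < s -> X r < X s).
{ intros r s h; apply Rmult_lt_compat_r; [easy|now apply hill_phase_increasing]. }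
assert (Y_incr : forall r s, r < s -> Y r < Y s).
{ intros r s h; apply Rmult_lt_compat_r; [easy|].
  apply Rplus_lt_compat_r; now apply hill_phase_increasing. }
assert (X_unbounded : forall A, {s | 0 < s /\ A <= X s}).
(* Chosen so that the lower bound [l pi/4 - pi/2], in units of [pi/2], is exactly [Rabs A]. *)
{ intros A; set (l := 2 * Rabs A + 2).
  assert (hA := Rabs_pos A); assert (hA' := Rle_abs A).
  assert (hl : 0 < l) by (unfold l; lra).
  exists (2 * l ^ 2); split; [generalize (pow_lt l 2 hl); lra|].
  assert (h := hill_phase_lower (k ^ 2) l hk2 hl).
  apply Rlt_le, (Rmult_le_compat_r (2 / PI)) in h; [|lra].
  replace ((l * (PI / 4) - PI / 2) * (2 / PI)) with (Rabs A) in h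
    by (unfold l; field; lra).
  unfold X; lra. }
assert (XY : forall s, -1 < X s - Y s < 1).
{ intros s; destruct (phase_gap (k ^ 2) s) as [h1 h2].
  apply (Rmult_lt_compat_r (2 / PI)) in h1; [|easy].
  apply (Rmult_lt_compat_r (2 / PI)) in h2; [|easy].
  unfold X, Y; lra. }
assert (XY_critical : forall s, 0 < s ->
    sin (PI * X s) = 0 -> sin (PI * Y s) = 0 -> False).
{ intros s hs; rewrite eX, eY; apply phases_not_both_critical; lra. }
assert (hp0 : forall t, hill_potential (k ^ 2) 0 t = k ^ 2)
  by (intros t; unfold hill_potential; ring).
assert (hpos : forall phi0, phi0 <= hill_phase (k ^ 2) 0 phi0 (PI / 2)).
{ intros phi0; rewrite <- (hill_phase_0 (k ^ 2) 0 phi0) at 1.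
  apply (phase_nondecreasing (hill_potential (k ^ 2) 0)); [apply hill_phase_is_phase| |lra].
  intros t; now rewrite hp0. }
destruct (phases_unperturbed (k ^ 2) 0 k hk hp0) as [r [hr e]].
destruct (floors_agree (X 0) (Y 0) r) as [m [hX0 hY0]]; auto.
- unfold X; apply Rmult_le_pos; [apply hpos|lra].
- unfold Y; apply Rmult_le_pos; [generalize (hpos (- (PI / 2)))|]; lra.
- rewrite eX, eY; exact e.
- set (S := alternation_points X Y m X_cont Y_cont X_unbounded XY hX0 hY0).
  exists S; split; [|split; [|split]].
  + intros n; rewrite Nat.add_1_r; now apply alternation_points_incr.
  + now apply alternation_points_diverge.
  + easy.
  + intros s _; split; intros [n hn].
    * apply stability_by_phases; rewrite <- eX, <- eY.
      now apply (same_sign_between X Y m X_cont Y_cont X_incr Y_incr X_unbounded XY hX0 hY0 n).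
    * apply stability_by_phases; rewrite <- eX, <- eY.
      now apply (opposite_sign_between X Y m X_cont Y_cont X_incr Y_incr X_unbounded XY
        hX0 hY0 XY_critical n).
Qed.

Theorem theorem2p3 (mu lambda1 lambda2 : R)
    (hmu : 0 < mu) (hlambda1 : 0 < lambda1) (hlambda2 : 0 < lambda2) :
  forall i : residual_mode,
  exists Em : nat -> R,
    (forall m : nat, Em m < Em (S m)) /\
    is_lim_seq Em p_infty /\
    Em 0%nat = 0 /\
    forall x0 E : R, x0 <> 0 ->
      E = mu ^ 2 / 2 * x0 ^ 2 ->
      ((exists k : nat, Em (2 * k)%nat < E < Em (2 * k + 1)%nat) ->
         non_activating mu lambda1 lambda2 x0 i) /\
      ((exists k : nat, Em (2 * k + 1)%nat < E < Em (2 * k + 2)%nat) ->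
         activating mu lambda1 lambda2 x0 i).
Proof.
intros i; set (lambda := residual_freq lambda1 lambda2 i).
assert (hlambda : 0 < lambda) by (unfold lambda; now destruct i).
destruct (hill_alternation (lambda / mu)) as [s [hincr [hlim [h0 hs]]]].
{ now apply Rdiv_lt_0_compat. }
(* The ratio of the energy [mu^2 x0^2 / 2] to the parameter [s = x0^2 / mu^2]. *)
set (K := mu ^ 4 / 2).
assert (hK : 0 < K) by (unfold K; generalize (pow_lt mu 4 hmu); lra).
exists (fun n => K * s n); split; [|split; [|split]].
- intros m; apply Rmult_lt_compat_l; [easy|].
  rewrite <- Nat.add_1_r; apply hincr.
- replace p_infty with (Rbar_mult K p_infty).
  + now apply is_lim_seq_scal_l.
  + simpl; destruct Rle_dec as [h|h]; [|lra].
    destruct Rle_lt_or_eq_dec; [easy|lra].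
- rewrite h0; ring.
- intros x0 E hx0 ->.
  set (r := x0 ^ 2 / mu ^ 2).
  assert (hr : 0 < r)
    by (apply Rdiv_lt_0_compat; [now apply pow2_gt_0|now apply pow_lt]).
  assert (eE : mu ^ 2 / 2 * x0 ^ 2 = K * r) by (unfold K, r; field; lra).
  assert (ea : mathieu_alpha mu lambda x0 = (lambda / mu) ^ 2 + r / 2)
    by (unfold mathieu_alpha, r; field; lra).
  assert (eq : mathieu_q mu x0 = r / 4) by (unfold mathieu_q, r; field; lra).
  destruct (hs r hr) as [h1 h2].
  unfold non_activating, activating; fold lambda; rewrite eE, ea, eq.
  split; intros [k [hk1 hk2]].
  + intros hn; apply hn, h1; exists k.
    split; apply (Rmult_lt_reg_l K); easy.
  + apply h2; exists k.
    split; apply (Rmult_lt_reg_l K); easy.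
Qed.
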